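(* Consider $N\ge1$ independent identically distributed non-explosive birth and death processes $\xi_1(t),\ldots,\xi_N(t)$ on $\{0,1,2,\ldots\}$ with birth rates $\lambda_i>0$ ($i\ge0$) and death rates $\mu_i>0$ ($i\ge1$), with spectral polynomials $\{Q_n(z)\}_{n\ge0}$, spectral measure $\psi$ and coefficients $\pi_j$. Let $X_k(t)=|\{j:\xi_j(t)=k\}|$, $\bm{X}(t)=(X_0(t),X_1(t),\ldots)$, and $p(\bm{x},\bm{y};t)=P(\bm{X}(t)=\bm{y}\mid\bm{X}(0)=\bm{x})$ for configurations $\bm{x},\bm{y}$ (sequences of non-negative integers indexed from $0$ with total $N$). (i) If the spectrum is discrete, with support $\{\zeta_l\}_{l\ge0}$, $\mu_0=0$, $\zeta_0=0$, and a stationary distribution $\bm{p}=(p_0,p_1,\ldots)$ of the individual processes exists, then $$p(\bm{x},\bm{y};t)=m(\bm{y};\bm{p})\Bigg\{1+\sum_{\{\bm{n}:0<|\bm{n}|\le N\}}e^{-t\sum_{i\ge1}n_i\zeta_i}\binom{N}{\bm{n}^+}^{-1}Q_{\bm{n}}(\bm{x};\bm{u})Q_{\bm{n}}(\bm{y};\bm{u})\Bigg\},$$ where $\{Q_{\bm{n}}(\bm{x};\bm{u})\}$ are the multivariate Krawtchouk polynomials with $$u_i^{(l)}=Q_i(\zeta_l)\sqrt{\psi(\{\zeta_l\})/\psi(\{0\})},\qquad i,l=0,1,\ldots.$$ (ii) If the spectrum is discrete, with support $\{\zeta_l\}_{l\ge0}$, and $\mu_0=0$, then $$p(\bm{x},\bm{y};t)=\widetilde{m}(\bm{y};\bm{\pi})\sum_{\{\bm{n}:0\le|\bm{n}|\le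 N\}}e^{-t\sum_{i\ge0}n_i\zeta_i}\binom{N}{\bm{n}^+}^{-1}Q_{\bm{n}}(\bm{x};\bm{u})Q_{\bm{n}}(\bm{y};\bm{u}),$$ where $\{Q_{\bm{n}}(\bm{x};\bm{u})\}$ are the multivariate Krawtchouk polynomials with $$u_i^{(l)}=Q_i(\zeta_l)\sqrt{\psi(\{\zeta_l\})},\qquad i,l=0,1,\ldots.$$ In this case $\zeta_0>0$, $u^{(0)}$ is not identically $1$, and $$\sum_{i\ge0}u_i^{(k)}u_i^{(l)}\pi_i=\delta_{kl},\qquad k,l=0,1,\ldots.$$ This covers the case when a stationary distribution does exist and also when a stationary distribution does not exist because $\sum_{k=0}^\infty\pi_k=\infty$.
   Context: Birth and death process: from state $i$ it moves to $i+1$ at rate $\lambda_i$ and to $i-1$ at rate $\mu_i$; non-explosive means only finitely many events occur in any finite time interval. Its transition functions are $p_{ij}(t)$. The spectral polynomials are defined by $Q_{-1}=0$, $Q_0=1$ and $$-zQ_n(z)=-(\lambda_n+\mu_n)Q_n(z)+\lambda_nQ_{n+1}(z)+\mu_nQ_{n-1}(z),\quad n\ge0.$$ Set $\pi_0=1$, $\pi_j=\frac{\lambda_0\cdots\lambda_{j-1}}{\mu_1\cdots\mu_j}$. The spectral measure $\psi$ is the (Karlin–McGregor) probability measure on $[0,\infty)$ with $$p_{ij}(t)=\pi_j\int_0^\infty e^{-zt}Q_i(z)Q_j(z)\,\psi(dz),\quad i,j\ge0,\ t\ge0.$$ The spectrum is discrete with support $\{\zeta_l\}_{l\ge0}$ if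 $\psi$ is a discrete measure with atoms of mass $\psi(\{\zeta_l\})>0$ at the distinct points $\zeta_l\ge0$. When $\mu_0=0$ and $\sum_k\pi_k<\infty$, the stationary distribution is $p_j=\pi_j/\sum_k\pi_k=\pi_j\psi(\{0\})$. Multi-indices are $\bm{n}=(n_1,n_2,\ldots)$, sequences of non-negative integers with sum $|\bm{n}|\le N$; $n_0=N-|\bm{n}|$, $\bm{n}^+=(n_0,n_1,\ldots)$, $\binom{N}{\bm{n}^+}=N!/\prod_{i\ge0}n_i!$. For $\bm{x}=(x_0,x_1,\ldots)$ with $|\bm{x}|=N$, $\binom{N}{\bm{x}}=N!/\prod_{j\ge0}x_j!$, $m(\bm{x};\bm{p})=\binom{N}{\bm{x}}\prod_{j\ge0}p_j^{x_j}$ and $\widetilde{m}(\bm{x};\bm{\pi})=\binom{N}{\bm{x}}\prod_{j\ge0}\pi_j^{x_j}$. For a family $\bm{u}=\{u^{(l)}\}_{l\ge0}$ of functions on $\{0,1,\ldots\}$, the multivariate Krawtchouk polynomial $Q_{\bm{n}}(\bm{x};\bm{u})$ is the coefficient of $\prod_{l\ge1}w_l^{n_l}$ in $$\prod_{j\ge0}\Big(u_j^{(0)}+\sum_{l\ge1}w_lu_j^{(l)}\Big)^{x_j}$$ (in case (i), $u^{(0)}_j=1$ for all $j$).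
   Formalization: In (ii), ''ζ_0>0'' is proved only when Σπ_k=∞; as stated it is false when a stationary distribution exists (e.g. λ_i=1, μ_i=i, ζ_l=l gives ζ_0=0). All other claims of (ii) are proved without this restriction. *)

(* Defs.v *)
(* MathComp / MathComp-Analysis *)
From HB Require Import structures.
From mathcomp Require Import all_boot all_order all_algebra.
From mathcomp Require Import finmap.
From mathcomp Require Import all_classical all_reals all_analysis.
Set Implicit Arguments.
Unset Strict Implicit.
Unset Printing Implicit Defensive.
Import Order.TTheory GRing.Theory Num.Theory.
Import numFieldNormedType.Exports.
Local Open Scope classical_set_scope.
Local Open Scope ring_scope.

Section BirthDeath.
Context {R : realType}.
Implicit Types (lambda mu zeta : nat -> R) (p : nat -> nat -> R -> R).

Definition birth_death_rate lambda mu (i j : nat) : R :=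
  if j == i.+1 then lambda i
  else if i == j.+1 then mu i
  else if i == j then - (lambda i + mu i)
  else 0.

(* p i j t stands for p_{ij}(t); only the values at t >= 0 matter. *)
Definition transition_function p : Prop :=
  [/\ (forall i j (t : R), 0 <= t -> 0 <= p i j t),
      (forall i j, p i j 0 = (i == j)%:R),
      (forall i (t : R), 0 <= t -> (\sum_(j <oo) (p i j t)%:E = 1%:E)%E)
    & (forall i j (s t : R), 0 <= s -> 0 <= t ->
         (p i j (s + t))%:E = (\sum_(k <oo) (p i k s * p k j t)%:E)%E)].

(* p_{ij}'(0+) is the rate of moving from i to j *)
Definition has_birth_death_rates lambda mu p : Prop :=
  forall i j, (p i j h - (i == j)%:R) / h @[h --> 0^'+]
              --> birth_death_rate lambda mu i j.

Definition stationary_distribution p (ps : nat -> R) : Prop :=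
  [/\ (forall i, 0 <= ps i), (\sum_(i <oo) (ps i)%:E = 1%:E)%E
    & (forall j (t : R), 0 <= t ->
         (\sum_(i <oo) (ps i * p i j t)%:E = (ps j)%:E)%E)].

Definition pi_coef lambda mu (j : nat) : R :=
  \prod_(i < j) (lambda i / mu i.+1).

(* Q n is Q_n; the last term encodes Q_{-1} = 0. As lambda n <> 0, the
   recurrence determines Q. *)
Definition spectral_polynomials lambda mu (Q : nat -> {poly R}) : Prop :=
  Q 0%N = 1 /\
  forall n, - 'X * Q n = - (lambda n + mu n) *: Q n + lambda n *: Q n.+1
                         + mu n *: (if n is m.+1 then Q m else 0).

Definition spectral_measure lambda mu p (Q : nat -> {poly R})
    (psi : probability (measurableTypeR R) R) : Prop :=
  psi `[0%R, +oo[%classic = 1%E /\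
  forall i j (t : R), 0 <= t ->
    let f (z : R) := (expR (- (z * t)) * (Q i).[z] * (Q j).[z])%:E in
    psi.-integrable `[0%R, +oo[%classic f /\
    (p i j t)%:E = ((pi_coef lambda mu j)%:E * \int[psi]_(z in `[0%R, +oo[) f z)%E.

Definition atom (psi : probability (measurableTypeR R) R) (z : R) : R :=
  fine (psi [set z]).

Definition discrete_spectrum (psi : probability (measurableTypeR R) R) zeta
    : Prop :=
  [/\ injective zeta, (forall l, 0 <= zeta l), (forall l, 0 < atom psi (zeta l))
    & psi (range zeta) = 1%E].

End BirthDeath.

Section Processes.
Context {d : measure_display} {T : measurableType d} {R : realType}.
Variable P : probability T R.
Implicit Types (xi : R -> T -> nat) (p : nat -> nat -> R -> R).

Definition cond_prob (A B : set T) : R := fine (P (A `&` B)) / fine (P B).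

Definition markov_process p xi : Prop :=
  (forall (t : R) (k : nat), 0 <= t -> measurable [set w | xi t w = k]) /\
  forall (s : nat -> R) (a : nat -> nat) (n : nat),
    0 <= s 0%N -> (forall k, s k <= s k.+1) ->
    let past := [set w | forall k, (k <= n)%N -> xi (s k) w = a k] in
    (0 < P past)%E ->
    cond_prob [set w | xi (s n.+1) w = a n.+1] past =
      p (a n) (a n.+1) (s n.+1 - s n).

(* The list e contains the event times in [0, t]. Since only a < b <= t with no
   event in (a, b] are compared, paths are right-continuous step functions. *)
Definition nonexplosive xi : Prop :=
  {ae P, forall w, forall t : R, exists e : seq R,
     forall a b : R, 0 <= a -> a < b -> b <= t ->
       (forall c, c \in e -> ~~ (a < c <= b)) -> xi a w = xi b w}.

(* The initial law of xi is left free, so that independent processes sharing p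
   may start from arbitrary states. *)
Definition birth_death_process (lambda mu : nat -> R) p xi : Prop :=
  [/\ transition_function p, has_birth_death_rates lambda mu p,
      markov_process p xi & nonexplosive xi].

Definition process_sigma_algebra xi : set (set T) :=
  <<s [set A | exists (t : R) (k : nat), 0 <= t /\ A = [set w | xi t w = k]] >>.

(* Since each A k may be the whole space, the product rule over all of 'I_N
   covers every subfamily. *)
Definition independent_processes N (xi : 'I_N -> R -> T -> nat) : Prop :=
  forall A : 'I_N -> set T, (forall k, process_sigma_algebra (xi k) (A k)) ->
    fine (P (\bigcap_(k in setT) A k)) = \prod_(k < N) fine (P (A k)).

(* the event X(t) = x *)
Definition counts_event N (xi : 'I_N -> R -> T -> nat) (t : R) (x : nat -> nat)
    : set T :=
  [set w | forall k : nat, #|[pred j : 'I_N | xi j t w == k]| = x k].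

End Processes.

(* Sequences of non-negative integers with finite sum, indexed from 0. A
   multi-index (n_1, n_2, ...) is such a sequence n with n 0 = 0. *)
Notation config := {fsfun nat -> nat with 0%N}.

Definition ctotal (x : config) : nat := (\sum_(i <- finsupp x) x i)%N.

(* n^+ *)
Definition full_index (N : nat) (n : config) : config :=
  [fsfun i in (0%N |` finsupp n)%fset =>
     if i == 0%N then (N - ctotal n)%N else n i | 0%N].

Section Krawtchouk.
Context {R : realType}.

Definition multinomial (N : nat) (x : config) : R :=
  N`!%:R / (\prod_(j <- finsupp x) (x j)`!)%N%:R.

(* m(x; p), and m~(x; pi) when q = pi *)
Definition multinomial_weight (N : nat) (x : config) (q : nat -> R) : R :=
  multinomial N x * \prod_(j <- finsupp x) q j ^+ x j.

(* Formal power series in w_0, w_1, ...: F n is the coefficient of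
   prod_l w_l^(n l). *)
Definition fps := config -> R.

Definition fps_one : fps := fun n => (ctotal n == 0%N)%:R.

Definition fps_mul (F G : fps) : fps := fun n =>
  \sum_(ab \in [set ab : config * config |
                  forall i : nat, (ab.1 i + ab.2 i)%N = n i]) F ab.1 * G ab.2.

Definition fps_exp (F : fps) (k : nat) : fps := iter k (fps_mul F) fps_one.

(* u_j^(0) + sum_(l >= 1) w_l u_j^(l), where u l j is u_j^(l) *)
Definition linear_series (u : nat -> nat -> R) (j : nat) : fps := fun n =>
  if ctotal n == 0%N then u 0%N j
  else if ctotal n == 1%N then \sum_(l <- finsupp n | (0 < l)%N) u l j
  else 0.

Definition krawtchouk (u : nat -> nat -> R) (n x : config) : R :=
  (\big[fps_mul/fps_one]_(j <- finsupp x) fps_exp (linear_series u j) (x j)) n.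

(* unordered sum over D; meaningful when the family is summable *)
Definition usum (I : choiceType) (D : set I) (f : I -> R) : R :=
  fine (\esum_(i in D) (EFin \o f)^\+ i - \esum_(i in D) (EFin \o f)^\- i)%E.

End Krawtchouk.

(* Main.v *)
(* The N processes are independent, so p(x, y; t) is, for any fixed assignment of the
   states of x to the particles, a sum over the assignments of the states of y;
   rewritten over the permutations sigma of the particles, it is a multiple of
   sum_sigma prod_a p_{x_a, y_(sigma a)}(t). Insert the spectral expansion
   p_{ij}(t) = pi_j sum_l e^{- t zeta_l} u_i^(l) u_j^(l) and expand the product over the
   particles: the terms are indexed by the labelings of the particles by spectral
   points l, and the labelings with the same counts n add up to
   Q_n(x; u) Q_n(y; u) / binom(N, n^+), because Q_n(x; u) is itself the sum of
   prod_a u_{x_a}^(L_a) over the labelings L with counts n.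

   The dual orthogonality of u is a completeness statement: by the
   Chapman-Kolmogorov equation, Parseval's identity with respect to (Q_k) holds for
   the functions z |-> e^{- n z}. It extends to the indicator of an atom zeta, the
   bounded pointwise limit of (1 - (e^{- z} - e^{- zeta})^2)^n.

   The stationary distribution is identified with pi_j psi({0}) by letting t tend to
   infinity. *)
Require Import Defs.
From HB Require Import structures.
From mathcomp Require Import all_boot all_order all_algebra.
From mathcomp Require Import fingroup perm finmap.
From mathcomp Require Import all_classical all_reals all_analysis.
From mathcomp Require Import measurable_realfun ring lra.
Set Implicit Arguments.
Unset Strict Implicit.
Unset Printing Implicit Defensive.
Import Order.TTheory GRing.Theory Num.Theory.
Import numFieldNormedType.Exports.
Local Open Scope classical_set_scope.
Local Open Scope ring_scope.

(** * Parseval's identity *)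

Section Parseval.
Context {R : realType} {V : lmodType R} (B : V -> V -> R).
Hypothesis B_linear : forall a f g h, B (a *: f + g) h = a * B f h + B g h.
Hypothesis B_sym : forall f g, B f g = B g f.
Hypothesis B_ge0 : forall f, 0 <= B f f.
Context (q : nat -> V) (w : nat -> R).
Hypothesis w_ge0 : forall k, 0 <= w k.
Hypothesis q_orth : forall i j, w j * B (q i) (q j) = (i == j)%:R.

(** The polarized defect in Bessel's inequality. Since [q k] has squared norm [1 / w k], it is the
    form [B] between the residuals of [f] and [g] after projection onto the first [K] vectors. *)
Definition bessel_gap (K : nat) (f g : V) : R :=
  B f g - \sum_(k < K) w k * B f (q k) * B g (q k).

Definition parseval (f : V) := bessel_gap K f f @[K --> \oo] --> 0.

Lemma bessel_gap_sym K f g : bessel_gap K f g = bessel_gap K g f.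
Proof.
by rewrite /bessel_gap B_sym; congr (_ - _); apply: eq_bigr => k _; rewrite mulrAC.
Qed.

Lemma bessel_gap_linear K a f g h :
  bessel_gap K (a *: f + g) h = a * bessel_gap K f h + bessel_gap K g h.
Proof.
rewrite /bessel_gap B_linear.
under eq_bigr do rewrite B_linear mulrDr mulrDl mulrCA -!mulrA.
by rewrite big_split/= -mulr_sumr; under [in RHS]eq_bigr do rewrite -mulrA;
  under [X in _ = _ + (_ - X)]eq_bigr do rewrite -mulrA; ring.
Qed.

Lemma B_linearr a f g h : B h (a *: f + g) = a * B h f + B h g.
Proof. by rewrite B_sym B_linear !(B_sym _ h). Qed.

Lemma B0l f : B 0 f = 0.
Proof. by have := B_linear (-1) f f f; rewrite scaleN1r addNr => ->; ring. Qed.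

Lemma B_suml (I : Type) (r : seq I) (F : I -> V) (c : I -> R) f :
  B (\sum_(i <- r) c i *: F i) f = \sum_(i <- r) c i * B (F i) f.
Proof.
elim: r => [|i r IH]; first by rewrite !big_nil B0l.
by rewrite !big_cons B_linear IH.
Qed.

(** The defect is the squared length of [f - s], with [s] the projection of [f] onto the span of the
    first [K] vectors. *)
Lemma bessel_gap_ge0 K f : 0 <= bessel_gap K f f.
Proof.
pose s := \sum_(i <- index_enum 'I_K) (w i * B f (q i)) *: q i.
have Bsf : B s f = \sum_(k < K) w k * B f (q k) * B f (q k).
  by rewrite B_suml; apply: eq_bigr => k _; rewrite (B_sym (q k)).
have Bsq (k : 'I_K) : w k * B s (q k) = w k * B f (q k).
  rewrite B_suml mulr_sumr (bigD1 k)//= big1 ?addr0.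
    by have := q_orth k k; rewrite eqxx => e; rewrite mulrCA e mulr1.
  by move=> i ik; rewrite mulrCA q_orth (negbTE ik : (i == k :> nat) = false) mulr0.
have Bss : B s s = B s f.
  rewrite {1}/s B_suml Bsf; apply: eq_bigr => k _.
  by rewrite mulrAC (B_sym (q k)) Bsq; ring.
have := B_ge0 ((-1) *: s + f).
by rewrite B_linear !B_linearr Bss (B_sym f s) Bsf /bessel_gap; lra.
Qed.

Lemma bessel_gap_le K f : bessel_gap K f f <= B f f.
Proof.
rewrite /bessel_gap gerBl; apply: sumr_ge0 => k _.
by rewrite -mulrA mulr_ge0// -expr2 sqr_ge0.
Qed.

Lemma bessel_gap_linearr K a f g h :
  bessel_gap K h (a *: f + g) = a * bessel_gap K h f + bessel_gap K h g.
Proof. by rewrite bessel_gap_sym bessel_gap_linear !(bessel_gap_sym _ h). Qed.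

(** Nonnegativity of the defect at [g - f] bounds the cross term, as for any semidefinite form. *)
Lemma bessel_gapD_le K f g :
  bessel_gap K (f + g) (f + g) <= 2 * bessel_gap K f f + 2 * bessel_gap K g g.
Proof.
have := bessel_gap_ge0 K ((-1) *: f + g).
have := bessel_gap_linear K 1 f g (f + g); rewrite scale1r => ->.
have := bessel_gap_linearr K 1 f g f; have := bessel_gap_linearr K 1 f g g.
rewrite scale1r => -> ->; rewrite bessel_gap_linear !bessel_gap_linearr.
by rewrite (bessel_gap_sym K g f); lra.
Qed.

Lemma bessel_gap_suml (I : Type) (r : seq I) (F : I -> V) (c : I -> R) K f :
  bessel_gap K (\sum_(i <- r) c i *: F i) f
  = \sum_(i <- r) c i * bessel_gap K (F i) f.
Proof.
elim: r => [|i r IH]; last by rewrite !big_cons bessel_gap_linear IH.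
rewrite !big_nil /bessel_gap B0l big1 ?subr0// => k _.
by rewrite B0l mulr0 mul0r.
Qed.

(** By bilinearity the defect of a combination is a finite double sum of mixed defects, which is why
    the hypothesis concerns pairs of vectors. *)
Lemma parseval_span (I : Type) (r : seq I) (F : I -> V) (c : I -> R) :
  (forall i j, bessel_gap K (F i) (F j) @[K --> \oo] --> 0) ->
  parseval (\sum_(i <- r) c i *: F i).
Proof.
move=> HF; rewrite /parseval.
have -> : (fun K => bessel_gap K (\sum_(i <- r) c i *: F i)
                               (\sum_(i <- r) c i *: F i)) =
    (fun K => \sum_(i <- r) \sum_(j <- r) c i * (c j * bessel_gap K (F j) (F i))).
  apply/funext => K; rewrite bessel_gap_suml; apply: eq_bigr => i _.
  by rewrite bessel_gap_sym bessel_gap_suml mulr_sumr.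
rewrite [X in _ --> X](_ : 0 = \sum_(i <- r) \sum_(j <- r) c i * (c j * 0)).
  apply: cvg_big => [|i _]; first exact: add_continuous.
  apply: cvg_big => [|j _]; first exact: add_continuous.
  by apply: cvgMr; apply: cvgMr; exact: HF.
by rewrite big1// => i _; rewrite big1// => j _; rewrite !mulr0.
Qed.

(** A defect never exceeds the squared norm, so replacing [f] by a nearby [g] costs an error uniform
    in [K]. *)
Lemma parseval_closed f :
  (forall e : R, 0 < e -> exists2 g, parseval g & B (f - g) (f - g) < e) ->
  parseval f.
Proof.
move=> Hf; apply/cvgrPdist_lt => e e0.
(* The splitting [f = g + (f - g)] puts a factor 2 on each of two terms, hence a quarter of [e] for
   each. *)
have e4 : 0 < e / 4 by rewrite divr_gt0.
have [g pg fg] := Hf _ e4.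
move/cvgrPdist_lt : pg => /(_ _ e4); apply: filterS => K.
rewrite !sub0r !normrN !ger0_norm ?bessel_gap_ge0// => gK.
have := bessel_gapD_le K g (f - g); rewrite addrC subrK => /le_lt_trans; apply.
by have := bessel_gap_le K (f - g); lra.
Qed.

(** Nonnegativity of the defect at [f + g] and [g - f] bounds twice the mixed defect by the sum of
    the two diagonal ones. *)
Lemma parseval_polar f g : parseval f -> parseval g ->
  bessel_gap K f g @[K --> \oo] --> 0.
Proof.
move=> pf pg; apply/cvgrPdist_lt => e e0.
move/cvgrPdist_lt : pf => /(_ _ e0) pf; move/cvgrPdist_lt : pg => /(_ _ e0) pg.
near=> K.
have : `|0 - bessel_gap K f f| < e by near: K.
have : `|0 - bessel_gap K g g| < e by near: K.
rewrite !sub0r !normrN !(ger0_norm (bessel_gap_ge0 _ _)) => gK fK.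
have := bessel_gap_ge0 K ((-1) *: f + g); have := bessel_gap_ge0 K (1 *: f + g).
rewrite !bessel_gap_linear !bessel_gap_linearr (bessel_gap_sym K g f) => h1 h2.
by rewrite ltr_norml; apply/andP; split; lra.
Unshelve. all: by end_near. Qed.

End Parseval.

(** * Square-integrable functions and their semidefinite inner product *)

Section SquareIntegrable.
Context {d} {T : measurableType d} {R : realType} (P : probability T R).

Lemma Lfun2_sqr (f : T -> R) : measurable_fun setT f ->
  P.-integrable setT (EFin \o (fun x => f x ^+ 2)) -> f \in Lfun P 2%:E.
Proof.
move=> mf /integrableP[_ fi]; rewrite inE; apply/andP; split; rewrite inE//=.
rewrite /finite_norm unlock /=; apply: poweR_lty; apply: le_lt_trans fi.
by under eq_integral => x _ do
  rewrite /= powR_mulrn// -normrX -abse_EFin.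
Qed.

Lemma Lfun2_bounded (f : T -> R) (M : R) : measurable_fun setT f ->
  (forall x, `|f x| <= M) -> f \in Lfun P 2%:E.
Proof.
move=> mf fM; apply: Lfun2_sqr => //; apply: measurable_bounded_integrable => //.
- exact: le_lt_trans (probability_le1 P measurableT) (ltry _).
- exact: measurable_funX.
- exists (M ^+ 2); split; first exact: num_real.
  move=> e Me x _ /=; apply: le_trans (ltW Me).
  by rewrite normrX ler_pXn2r// ?nnegrE// (le_trans _ (fM x)).
Qed.

Lemma Lfun2_mul_integrable (f g : T -> R) :
  f \in Lfun P 2%:E -> g \in Lfun P 2%:E ->
  P.-integrable setT (fun x => (f x * g x)%:E).
Proof. by move=> f2 g2; apply/Lfun1_integrable/Lfun2_mul_Lfun1. Qed.

Local Notation L2 := (LfunType P (lee1n 2)).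

(** The arguments are functions, not classes modulo null sets, so that they can be evaluated at an
    atom; the form is accordingly only semidefinite. *)
Definition L2dot (f g : L2) : R := Rintegral P setT (f \* g).

Lemma L2dot_linear a (f g h : L2) :
  L2dot (a *: f + g) h = a * L2dot f h + L2dot g h.
Proof.
have i (u v : L2) : P.-integrable setT (EFin \o (u \* v)).
  by apply: Lfun2_mul_integrable; exact: LfunP.
rewrite /L2dot -RintegralZl//; last exact: i.
rewrite -RintegralD//; last 2 first.
- by have := integrableZl measurableT a (i f h).
- exact: i.
by apply: eq_Rintegral => x _ /=; rewrite mulrDl -mulrA.
Qed.

Lemma L2dot_sym (f g : L2) : L2dot f g = L2dot g f.
Proof. by apply: eq_Rintegral => x _ /=; rewrite mulrC. Qed.

Lemma L2dot_ge0 (f : L2) : 0 <= L2dot f f.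
Proof. by apply: Rintegral_ge0 => x _ /=; rewrite -expr2 sqr_ge0. Qed.

End SquareIntegrable.

(** * The spectral measure *)

Lemma nneseries_cvg {R : realType} (f : nat -> R) (s : R) : (forall k, 0 <= f k) ->
  (\sum_(k <oo) (f k)%:E = s%:E)%E -> \sum_(k < K) f k @[K --> \oo] --> s.
Proof.
move=> f0 fs; rewrite -[s]/(fine s%:E).
apply: (@fine_cvg _ _ _ _ (fun K => (\sum_(k < K) f k)%:E)).
rewrite -fs (_ : (fun K => (\sum_(k < K) f k)%:E) =
    (fun n => \sum_(0 <= i < n) (f i)%:E)%E).
  by apply: is_cvg_nneseries => n _ _; rewrite lee_fin.
by apply/funext => n /=; rewrite sumEFin big_mkord.
Qed.

Lemma indic_set1 {R : realType} (a z : R) : \1_[set a] z = (z == a)%:R :> R.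
Proof.
rewrite indicE; congr (nat_of_bool _)%:R.
by apply/idP/eqP; rewrite inE.
Qed.

Lemma Rintegral_atom {R : realType} (psi : probability (measurableTypeR R) R)
    (f : measurableTypeR R -> R) (a : R) :
  Rintegral psi setT (fun z => (z == a)%:R * f z) = f a * atom psi a.
Proof.
transitivity (Rintegral psi [set a] (fun=> f a)).
  rewrite -(@eq_Rintegral _ _ _ psi [set a] (fun=> f a) f) => [|z]; last first.
    by rewrite inE => ->.
  rewrite [RHS]Rintegral_mkcond; apply: eq_Rintegral => z _ /=.
  by rewrite /patch -indic_set1 indicE; case: ifPn => _; rewrite ?mul1r ?mul0r.
by rewrite Rintegral_cst.
Qed.

Section SpectralMeasure.
Context {R : realType} (lambda mu : nat -> R) (p : nat -> nat -> R -> R).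
Context (Q : nat -> {poly R}) (psi : probability (measurableTypeR R) R).
Hypothesis pi_gt0 : forall j, 0 < pi_coef lambda mu j.
Hypothesis Q0 : Q 0%N = 1.
Hypothesis hp : transition_function p.
Hypothesis hpsi : spectral_measure lambda mu p Q psi.

Local Notation TR := (measurableTypeR R).
Local Notation D := (`[0%R, +oo[%classic : set TR).
Local Notation pi := (pi_coef lambda mu).

Lemma psi_neg : psi (~` D) = 0%E.
Proof. by rewrite probability_setC// hpsi.1 subee. Qed.

Lemma psi_integrable (f : TR -> R) : measurable_fun setT f ->
  psi.-integrable D (EFin \o f) -> psi.-integrable setT (EFin \o f).
Proof.
move=> mf fi; have mD : measurable (~` D) by exact: measurableC.
have mf' : measurable_fun setT (EFin \o f) by exact/measurable_EFinP.
by apply/(negligible_integrable mD measurableT mf' psi_neg); rewrite setTD setCK.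
Qed.

Lemma psi_integral (f : TR -> R) : measurable_fun setT f ->
  psi.-integrable D (EFin \o f) ->
  (\int[psi]_x (f x)%:E = \int[psi]_(x in D) (f x)%:E)%E.
Proof.
move=> mf fi; have mD : measurable (~` D) by exact: measurableC.
by rewrite (negligible_integral mD measurableT (psi_integrable mf fi) psi_neg)
  setTD setCK.
Qed.

(* [damp ^+ n] is [exp (- n z)] on the support and stays in [0, 1] elsewhere. *)
Definition damp (z : R) : R := (0 <= z)%R%:R * expR (- z).

Lemma dampXE n z : 0 <= z -> damp z ^+ n = expR (- (z * n%:R)).
Proof. by move=> z0; rewrite /damp z0 mul1r -expRM_natr mulNr. Qed.

Lemma damp_ge0 z : 0 <= damp z.
Proof. by rewrite /damp mulr_ge0// expR_ge0. Qed.

Lemma damp_le1 z : damp z <= 1.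
Proof.
rewrite /damp; case: (lerP 0 z) => z0; last by rewrite mul0r.
by rewrite mul1r -expR0 ler_expR oppr_le0.
Qed.

Lemma measurable_damp : measurable_fun [set: TR] damp.
Proof.
suff : measurable_fun [set: R] damp by [].
apply: measurable_funM.
  rewrite (_ : (fun _ => _) = \1_D); first exact: measurable_indic.
  by apply/funext => z; rewrite indicE/= mem_setE in_itv/= andbT.
by apply: measurableT_comp => //; exact: measurableT_comp.
Qed.

Definition qfun i (z : R) : R := (Q i).[z].

Lemma measurable_qfun i : measurable_fun [set: TR] (qfun i).
Proof.
suff : measurable_fun [set: R] (qfun i) by [].
by apply: continuous_measurable_fun; exact: continuous_horner. Qed.

(** At integer times the exponential is a power of [damp], and [psi] does not charge the negative
    half-line, so the spectral representation becomes an integral over the whole line. *)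
Lemma damp_spectral i j n :
  psi.-integrable setT (fun z : TR => (damp z ^+ n * qfun i z * qfun j z)%:E) /\
  p i j n%:R = pi j * Rintegral psi setT (fun z : TR => damp z ^+ n * qfun i z * qfun j z).
Proof.
have mf : measurable_fun setT (fun z : TR => damp z ^+ n * qfun i z * qfun j z).
  do 2?[apply: measurable_funM]; try exact: measurable_qfun.
  by apply: measurable_funX; exact: measurable_damp.
have [fi pE] := hpsi.2 i j n%:R (ler0n _ _).
have eD (z : TR) : z \in D -> (expR (- (z * n%:R)) * (Q i).[z] * (Q j).[z])%:E
    = (damp z ^+ n * qfun i z * qfun j z)%:E.
  by rewrite inE/= in_itv/= andbT => z0; rewrite dampXE.
have fiD : psi.-integrable D
    (EFin \o (fun z : TR => damp z ^+ n * qfun i z * qfun j z)).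
  by apply: eq_integrable fi => // z; exact: eD.
split; first exact: psi_integrable.
apply: EFin_inj; rewrite pE EFinM; congr (_ * _)%E.
rewrite /Rintegral fineK; last exact/integrable_fin_num/psi_integrable/fiD.
by rewrite psi_integral//; apply: eq_integral.
Qed.

Lemma qfun_L2 i : (qfun i : TR -> R) \in Lfun psi 2%:E.
Proof.
apply: Lfun2_sqr; first exact: measurable_qfun.
have [+ _] := damp_spectral i i 0.
by apply: eq_integrable => // z _ /=; rewrite expr0 mul1r expr2.
Qed.

Lemma damp_poly_L2 (r : {poly R}) : (fun z : TR => r.[damp z]) \in Lfun psi 2%:E.
Proof.
apply: (@Lfun2_bounded _ _ _ _ _ (\sum_(i < size r) `|r`_i|)).
  apply: (measurableT_comp (f := horner r : R -> R)); last exact: measurable_damp.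
  by apply: continuous_measurable_fun; exact: continuous_horner.
move=> z; rewrite horner_coef (le_trans (ler_norm_sum _ _ _))//.
apply: ler_sum => i _; rewrite normrM ler_piMr// normrX exprn_ile1//.
by rewrite ger0_norm ?damp_ge0// damp_le1.
Qed.

Lemma atom_L2 (a : R) : (\1_[set a] : TR -> R) \in Lfun psi 2%:E.
Proof.
apply: (@Lfun2_bounded _ _ _ _ _ 1); first exact: measurable_indic.
by move=> z; rewrite indicE ger0_norm// lern1 leq_b1.
Qed.

Local Notation L2 := (LfunType psi (lee1n 2)).

Lemma L2_sumE (I : Type) (r : seq I) (c : I -> R) (F : I -> L2) z :
  (\sum_(i <- r) c i *: F i) z = \sum_(i <- r) c i * F i z.
Proof. by elim: r => [|i r IH]; rewrite ?big_nil// !big_cons -IH. Qed.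

Definition L2q i : L2 := Lfun_Sub (lee1n 2) (qfun_L2 i).
Definition L2poly r : L2 := Lfun_Sub (lee1n 2) (damp_poly_L2 r).
Definition L2atom a : L2 := Lfun_Sub (lee1n 2) (atom_L2 a).

(** This is the spectral representation at time 0, where [p i j 0] is the Kronecker delta. *)
Lemma L2q_orth i j : pi j * L2dot (L2q i) (L2q j) = (i == j)%:R.
Proof.
have [_ + _ _] := hp; move=> /(_ i j) <-.
have [_] := damp_spectral i j 0; rewrite mulr0n => ->; congr (_ * _).
by apply: eq_Rintegral => z _ /=; rewrite expr0 mul1r.
Qed.

Lemma L2dot_polyX_q s k : pi k * L2dot (L2poly 'X^s) (L2q k) = p 0 k s%:R.
Proof.
have [_ ->] := damp_spectral 0 k s; congr (_ * _).
by apply: eq_Rintegral => z _ /=; rewrite hornerXn /qfun Q0 hornerC mulr1.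
Qed.

(** The inner product of [L2dot_polyX_q] read with exchanged indices, where the weight [pi 0] is 1.
    Using one reading for each factor turns a Parseval term into [p 0 k s * p k 0 t]. *)
Lemma L2dot_polyX_q0 s k : L2dot (L2poly 'X^s) (L2q k) = p k 0 s%:R.
Proof.
have [_ ->] := damp_spectral k 0 s; rewrite /pi_coef big_ord0 mul1r.
by apply: eq_Rintegral => z _ /=; rewrite hornerXn /qfun Q0 hornerC mulr1.
Qed.

Lemma L2dot_polyX s t : L2dot (L2poly 'X^s) (L2poly 'X^t) = p 0 0 (s%:R + t%:R).
Proof.
rewrite -natrD; have [_ ->] := damp_spectral 0 0 (s + t).
rewrite /pi_coef big_ord0 mul1r.
by apply: eq_Rintegral => z _ /=; rewrite !hornerXn /qfun Q0 hornerC !mulr1 exprD.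
Qed.

Lemma L2atom_dot a (f : L2) : L2dot (L2atom a) f = f a * atom psi a.
Proof.
by rewrite -Rintegral_atom; apply: eq_Rintegral => z _ /=; rewrite indic_set1.
Qed.

(* Chapman-Kolmogorov is Parseval's identity for the exponentials. *)
Lemma bessel_gap_polyX s t :
  bessel_gap (@L2dot _ _ _ psi) L2q pi K (L2poly 'X^s) (L2poly 'X^t)
    @[K --> \oo] --> 0.
Proof.
have [p0 _ _ /(_ 0%N 0%N s%:R t%:R (ler0n _ _) (ler0n _ _))/esym pE] := hp.
have := nneseries_cvg _ pE.
move=> /(_ (fun k => mulr_ge0 (p0 _ _ _ (ler0n _ _)) (p0 _ _ _ (ler0n _ _)))).
set S := (X in X @ _ --> _) => Sp.
have -> : (fun K => bessel_gap (@L2dot _ _ _ psi) L2q pi K (L2poly 'X^s) (L2poly 'X^t))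
   = (fun K => p 0 0 (s%:R + t%:R) - S K).
  apply/funext => K; rewrite /bessel_gap L2dot_polyX; congr (_ - _).
  by apply: eq_bigr => k _; rewrite L2dot_polyX_q L2dot_polyX_q0.
by rewrite -(subrr (p 0 0 (s%:R + t%:R))); apply: cvgB => //; exact: cvg_cst.
Qed.

Lemma parseval_poly r : parseval (@L2dot _ _ _ psi) L2q pi (L2poly r).
Proof.
have -> : L2poly r = \sum_(i <- index_enum 'I_(size r)) r`_i *: L2poly 'X^i.
  apply/LfuneqP => z; rewrite L2_sumE /= horner_coef.
  by apply: eq_bigr => i _; rewrite hornerXn.
apply: parseval_span; [exact: L2dot_linear|exact: L2dot_sym|].
by move=> i j; exact: bessel_gap_polyX.
Qed.


(** Evaluated at [damp z] with [a >= 0], it is 1 for [z = a] and tends to 0 with [n] for every other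
    [z]. *)
Definition bump (a : R) (n : nat) : {poly R} := (1 - ('X - (damp a)%:P) ^+ 2) ^+ n.

Lemma bumpE a n x : (bump a n).[x] = (1 - (x - damp a) ^+ 2) ^+ n.
Proof. by rewrite /bump horner_exp !hornerE. Qed.

(** The exponential separates nonnegative points, and negative points go to 0, which is never the
    value at a nonnegative [a]. *)
Lemma damp_eq a z : 0 <= a -> (damp z == damp a) = (z == a).
Proof.
move=> a0; rewrite /damp a0 mul1r; case: (lerP 0 z) => z0.
  by rewrite mul1r (inj_eq (@expR_inj R)) eqr_opp.
by rewrite mul0r lt_eqF ?expR_gt0// lt_eqF// (lt_le_trans z0).
Qed.

Lemma bump_base a z : 0 <= 1 - (damp z - damp a) ^+ 2 <= 1.
Proof.
rewrite subr_ge0 gerBl sqr_ge0 andbT -real_normK ?num_real// expr_le1//.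
have := damp_ge0 z; have := damp_ge0 a; have := damp_le1 z; have := damp_le1 a.
by move=> *; rewrite ler_norml; apply/andP; split; lra.
Qed.

Lemma bump_cvg a z : 0 <= a ->
  ((z == a)%:R - (bump a n).[damp z]) ^+ 2 @[n --> \oo] --> 0.
Proof.
move=> a0; have [->|za] := eqVneq z a.
  rewrite (_ : (fun _ => _) = cst 0); first exact: cvg_cst.
  by apply/funext => n; rewrite bumpE subrr expr0n subr0 expr1n subrr expr0n.
rewrite [X in _ --> X](_ : 0 = (0 - 0) ^+ 2); last by rewrite subrr expr0n.
apply: (@cvgM _ _ _ _ (fun n => 0 - (bump a n).[damp z]) (fun n => 0 - (bump a n).[damp z]));
  (apply: cvgB; first exact: cvg_cst);
  (rewrite (_ : (fun n => _) = GRing.exp (1 - (damp z - damp a) ^+ 2));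
    last by apply/funext => n; rewrite bumpE);
  apply: cvg_expr; have /andP[b0 _] := bump_base a z;
  by rewrite ger0_norm// gtrBl exprn_even_gt0//= subr_eq0 damp_eq.
Qed.

Lemma parseval_atom a : 0 <= a -> parseval (@L2dot _ _ _ psi) L2q pi (L2atom a).
Proof.
move=> a0; apply: parseval_closed.
- exact: L2dot_linear.
- exact: L2dot_sym.
- exact: L2dot_ge0.
- by move=> k; exact/ltW.
- exact: L2q_orth.
move=> e e0.
(* The squared distance tends to 0 pointwise and is at most 1, both functions having values in
   [0, 1]; dominated convergence makes the bumps approximate the indicator in mean square. *)
pose F n (z : TR) := ((\1_[set a] z - (bump a n).[damp z]) ^+ 2)%:E.
have mF n : measurable_fun setT (F n).
  have := LfunP (L2atom a - L2poly (bump a n)); rewrite inE => /andP[+ _].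
  by rewrite inE/= => mf; apply/measurable_EFinP; exact: measurable_funX.
have : (\int[psi]_x F n x @[n --> \oo] --> \int[psi]_x 0)%E.
  apply: (@dominated_cvg _ _ _ psi setT measurableT F (cst 0%E) (cst 1%E)) => //.
  - move=> z _; apply: cvg_EFin; first exact: nearW.
    by rewrite /F/=; under eq_fun do rewrite indic_set1; exact: bump_cvg.
  - by apply: finite_measure_integrable_cst.
  - move=> n z _; rewrite /F /= lee_fin bumpE ger0_norm ?sqr_ge0//.
    rewrite -real_normK ?num_real// expr_le1// indicE.
    have /andP[b0 b1] := bump_base a z.
    have c0 := exprn_ge0 n b0; have c1 := exprn_ile1 n b0 b1.
    by case: (z \in _); rewrite ler_norml; apply/andP; split; rewrite ?mulr1n ?mulr0n; lra.
rewrite integral0 => /fine_cvg /cvgrPdist_lt /(_ _ e0) [n _ /(_ n (leqnn n))] /=.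
rewrite sub0r normrN => Fn; exists (L2poly (bump a n)); first exact: parseval_poly.
apply: le_lt_trans Fn; apply: le_trans (ler_norm _); rewrite le_eqVlt; apply/orP; left.
by apply/eqP; apply: eq_Rintegral => z _ /=; rewrite -expr2.
Qed.

(** Polarized Parseval for the indicators of [a] and [b]: the inner product of an indicator with
    [qfun k] is the value at the point times its mass. *)
Lemma dual_orthogonality a b : 0 <= a -> 0 <= b ->
  \sum_(k < K) pi k * (qfun k a * atom psi a) * (qfun k b * atom psi b)
    @[K --> \oo] --> (a == b)%:R * atom psi b.
Proof.
move=> a0 b0.
have h := parseval_polar (@L2dot_linear _ _ _ psi) (@L2dot_sym _ _ _ psi)
  (@L2dot_ge0 _ _ _ psi) L2q_orth
  (parseval_atom a0) (parseval_atom b0).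
have -> : (fun K => \sum_(k < K) pi k * (qfun k a * atom psi a) * (qfun k b * atom psi b))
  = (fun K => L2dot (L2atom a) (L2atom b)
     - bessel_gap (@L2dot _ _ _ psi) L2q pi K (L2atom a) (L2atom b)).
  apply/funext => K; rewrite opprB addrC subrK.
  by apply: eq_bigr => k _; rewrite !L2atom_dot.
rewrite -[X in _ --> X]subr0; apply: cvgB => //.
rewrite (_ : _ * _ = L2dot (L2atom a) (L2atom b)); first exact: cvg_cst.
by rewrite L2dot_sym L2atom_dot/= indic_set1 eq_sym.
Qed.

End SpectralMeasure.

(** * Unordered sums *)

Section UnorderedSums.
Context {R : realType}.

(** Summability is recorded along with the value, because [fine] in [usum] sends infinite values to
    0. *)
Definition has_usum (I : choiceType) (D : set I) (f : I -> R) (s : R) :=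
  summable D (EFin \o f) /\ usum D f = s.

(** Any difference of nonnegative functions with finite sums will do, not only the positive and
    negative parts; each later rule picks a decomposition suited to its operation. *)
Lemma has_usumB (I : choiceType) (D : set I) (f g h : I -> R) (a b : R) :
  (forall i, D i -> f i = g i - h i) ->
  (forall i, D i -> 0 <= g i) -> (forall i, D i -> 0 <= h i) ->
  (\esum_(i in D) (g i)%:E = a%:E)%E -> (\esum_(i in D) (h i)%:E = b%:E)%E ->
  has_usum D f (a - b).
Proof.
move=> fgh g0 h0 ga hb.
have sg : summable D (EFin \o g).
  rewrite /summable (eq_esum (b := EFin \o g)) ?ga ?ltry// => i Di.
  by rewrite /= ger0_norm// g0.
have sh : summable D (EFin \o h).
  rewrite /summable (eq_esum (b := EFin \o h)) ?hb ?ltry// => i Di.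
  by rewrite /= ger0_norm// h0.
split.
  have := summableB sg sh; rewrite /summable.
  by rewrite (eq_esum (b := fun i => `|(EFin \o f) i|%E))// => i Di /=; rewrite fgh.
have -> : usum D f = fine (\esum_(i in D) ((EFin \o g) \- (EFin \o h))^\+ i
    - \esum_(i in D) ((EFin \o g) \- (EFin \o h))^\- i)%E.
  rewrite /usum; congr fine; congr (_ - _)%E; apply: eq_esum => i Di;
    by rewrite ?funeposE ?funenegE /= fgh.
rewrite esumB//; first by rewrite /= ga hb.
Qed.

Lemma has_usum_posneg (I : choiceType) (D : set I) (f : I -> R) (s : R) :
  has_usum D f s -> exists a b,
  [/\ (\esum_(i in D) (Num.max (f i) 0)%:E = a%:E)%E,
      (\esum_(i in D) (Num.max (- f i) 0)%:E = b%:E)%E & s = a - b].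
Proof.
move=> [sf <-].
have sp := summable_funepos sf; have sn := summable_funeneg sf.
move: sp sn; rewrite !summableE.
have pE : (\esum_(i in D) `|(EFin \o f)^\+ i| = \esum_(i in D) (EFin \o f)^\+ i)%E.
  by apply: eq_esum => i _; rewrite gee0_abs.
have nE : (\esum_(i in D) `|(EFin \o f)^\- i| = \esum_(i in D) (EFin \o f)^\- i)%E.
  by apply: eq_esum => i _; rewrite gee0_abs.
rewrite pE nE => fp fn.
exists (fine (\esum_(i in D) (EFin \o f)^\+ i)%E),
  (fine (\esum_(i in D) (EFin \o f)^\- i)%E).
rewrite !fineK//; split.
- by apply: eq_esum => i _; rewrite funeposE /= EFin_max.
- by apply: eq_esum => i _; rewrite funenegE /= EFin_max.
- by rewrite /usum fineB.
Qed.

Lemma max_posneg (x : R) : x = Num.max x 0 - Num.max (- x) 0.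
Proof. by case: (lerP 0 x) => x0; [rewrite max_r|rewrite max_l]; lra. Qed.

Lemma eq_has_usum (I : choiceType) (D : set I) (f g : I -> R) s :
  (forall i, D i -> f i = g i) -> has_usum D f s -> has_usum D g s.
Proof.
move=> fg /has_usum_posneg [a [b [fa fb ->]]].
apply: has_usumB fa fb => i Di.
- by rewrite -fg// [LHS]max_posneg.
- by rewrite le_max lexx orbT.
- by rewrite le_max lexx orbT.
Qed.

Lemma has_usum0 (I : choiceType) (D : set I) : has_usum D (fun=> 0) 0.
Proof.
rewrite -[X in has_usum _ _ X](subrr 0).
by apply: (has_usumB (g := fun=> 0) (h := fun=> 0)) => [i _||||];
  rewrite ?subrr//; exact: esum1.
Qed.

Lemma has_usumD (I : choiceType) (D : set I) (f g : I -> R) s t :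
  has_usum D f s -> has_usum D g t -> has_usum D (fun i => f i + g i) (s + t).
Proof.
move=> /has_usum_posneg [a [b [fa fb ->]]] /has_usum_posneg [c [e [gc ge ->]]].
have -> : a - b + (c - e) = (a + c) - (b + e) by ring.
have m0 (x : R) : 0 <= Num.max x 0 by rewrite le_max lexx orbT.
apply: (has_usumB (g := fun i => Num.max (f i) 0 + Num.max (g i) 0)
                  (h := fun i => Num.max (- f i) 0 + Num.max (- g i) 0)).
- by move=> i _; rewrite {1}[f i]max_posneg {1}[g i]max_posneg; ring.
- by move=> i _; rewrite addr_ge0.
- by move=> i _; rewrite addr_ge0.
- under eq_esum do rewrite EFinD; rewrite esumD => [|i _|i _]; rewrite ?lee_fin//.
  by rewrite fa gc.
- under eq_esum do rewrite EFinD; rewrite esumD => [|i _|i _]; rewrite ?lee_fin//.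
  by rewrite fb ge.
Qed.

(** Scaling finite subsums gives one inequality; for [c > 0] the reverse one is the same inequality
    with factor [c^-1]. *)
Lemma esumZl (I : choiceType) (D : set I) (f : I -> R) (c a : R) : 0 <= c ->
  (forall i, D i -> 0 <= f i) ->
  (\esum_(i in D) (f i)%:E = a%:E)%E -> (\esum_(i in D) (c * f i)%:E = (c * a)%:E)%E.
Proof.
have le (g : I -> R) c' b : 0 <= c' -> (\esum_(i in D) (g i)%:E = b%:E)%E ->
    (\esum_(i in D) (c' * g i)%:E <= (c' * b)%:E)%E.
  move=> c'0 gb; apply: ge_ereal_sup => _ [A [fA AD] <-].
  rewrite fsbig_finite//= sumEFin -mulr_sumr lee_fin ler_wpM2l//.
  rewrite -lee_fin -gb; apply: esum_ge; exists A => //.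
  by rewrite fsbig_finite//= sumEFin.
rewrite le_eqVlt => /predU1P[<-|c0] f0 fa.
  by rewrite mul0r; apply: esum1 => i _; rewrite mul0r.
have [b cfb] : exists b, (\esum_(i in D) (c * f i)%:E = b%:E)%E.
  exists (fine (\esum_(i in D) (c * f i)%:E)%E); rewrite fineK// ge0_fin_numE.
    by rewrite (le_lt_trans (le _ _ _ (ltW c0) fa))// ltry.
  by apply: esum_ge0 => i Di; rewrite lee_fin mulr_ge0 ?f0 ?ltW.
have := le _ _ _ (ltW c0) fa; rewrite cfb lee_fin => bca.
have ci0 : 0 <= c^-1 by rewrite invr_ge0 ltW.
have := le _ _ _ ci0 cfb; under eq_esum do rewrite mulKf ?gt_eqF//.
rewrite fa lee_fin mulrC ler_pdivlMr// mulrC => cab.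
by congr EFin; apply/eqP; rewrite eq_le bca.
Qed.

Lemma has_usumZ (I : choiceType) (D : set I) (f : I -> R) c s :
  has_usum D f s -> has_usum D (fun i => c * f i) (c * s).
Proof.
move=> /has_usum_posneg [a [b [fa fb ->]]].
have m0 (x : R) : 0 <= Num.max x 0 by rewrite le_max lexx orbT.
have [c0|c0] := lerP 0 c.
  rewrite mulrBr; apply: has_usumB (esumZl c0 _ fa) (esumZl c0 _ fb) => // i _;
    by rewrite -?mulrBr -?max_posneg ?mulr_ge0.
have c0' : 0 <= - c by rewrite oppr_ge0 ltW.
have -> : c * (a - b) = - c * b - - c * a by ring.
apply: has_usumB (esumZl c0' _ fb) (esumZl c0' _ fa) => // i _;
  rewrite -?mulrBr ?mulr_ge0//.
by rewrite {1}[f i]max_posneg; ring.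
Qed.

Lemma has_usum_sum (I : choiceType) (D : set I) (K : Type) (r : seq K)
    (f : K -> I -> R) (s : K -> R) :
  (forall k, has_usum D (f k) (s k)) ->
  has_usum D (fun i => \sum_(k <- r) f k i) (\sum_(k <- r) s k).
Proof.
move=> fs; elim: r => [|k r IH].
  by rewrite big_nil; apply: eq_has_usum (has_usum0 D) => i _; rewrite big_nil.
rewrite big_cons; apply: eq_has_usum (has_usumD (fs k) IH) => i _.
by rewrite big_cons.
Qed.

Lemma reindex_has_usum (I J : choiceType) (D : set I) (E : set J) (e : I -> J)
    (f : J -> R) s : set_bij D E e ->
  has_usum D (fun i => f (e i)) s -> has_usum E f s.
Proof.
move=> De /has_usum_posneg [a [b [fa fb ->]]].
have m0 (x : R) : 0 <= Num.max x 0 by rewrite le_max lexx orbT.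
apply: (has_usumB (g := fun i => Num.max (f i) 0)
                  (h := fun i => Num.max (- f i) 0)) => // [i _||].
- exact: max_posneg.
- by rewrite (@reindex_esum _ _ _ _ _ _ _ De).
- by rewrite (@reindex_esum _ _ _ _ _ _ _ De).
Qed.

Lemma esumM (I J : choiceType) (f : I -> R) (g : J -> R) a b :
  (forall i, 0 <= f i) -> (forall j, 0 <= g j) ->
  (\esum_(i in [set: I]) (f i)%:E = a%:E)%E ->
  (\esum_(j in [set: J]) (g j)%:E = b%:E)%E ->
  (\esum_(k in [set: I * J]) (f k.1 * g k.2)%:E = (a * b)%:E)%E.
Proof.
move=> f0 g0 fa gb.
have -> : [set: I * J] = setT `*`` (fun=> setT) by apply/seteqP; split.
rewrite -(esum_esum (a := fun i j => (f i * g j)%:E)) => [|i j _ _]; last first.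
  by rewrite lee_fin mulr_ge0.
under eq_esum => i _ do rewrite (esumZl (f0 i) (fun j _ => g0 j) gb) mulrC.
rewrite mulrC; apply: esumZl fa => //.
by rewrite -lee_fin -gb esum_ge0// => j _; rewrite lee_fin.
Qed.

(** With both factors split into positive and negative parts, products of like parts form the
    positive side of the decomposition and mixed products the negative side. *)
Lemma has_usumM (I J : choiceType) (f : I -> R) (g : J -> R) s t :
  has_usum setT f s -> has_usum setT g t ->
  has_usum [set: I * J] (fun k => f k.1 * g k.2) (s * t).
Proof.
move=> /has_usum_posneg [a [b [fa fb ->]]] /has_usum_posneg [c [e [gc ge ->]]].
have m0 (x : R) : 0 <= Num.max x 0 by rewrite le_max lexx orbT.
have -> : (a - b) * (c - e) = (a * c + b * e) - (a * e + b * c) by ring.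
have Hm (x y : R) : 0 <= Num.max x 0 * Num.max y 0 by rewrite mulr_ge0.
apply: (has_usumB
  (g := fun k => Num.max (f k.1) 0 * Num.max (g k.2) 0
                 + Num.max (- f k.1) 0 * Num.max (- g k.2) 0)
  (h := fun k => Num.max (f k.1) 0 * Num.max (- g k.2) 0
                 + Num.max (- f k.1) 0 * Num.max (g k.2) 0)).
- by move=> k _; rewrite {1}[f k.1]max_posneg {1}[g k.2]max_posneg; ring.
- by move=> k _; rewrite addr_ge0.
- by move=> k _; rewrite addr_ge0.
- under eq_esum do rewrite EFinD; rewrite esumD => [|i _|i _]; rewrite ?lee_fin//.
  rewrite (esumM (f := fun i => Num.max (f i) 0)
    (g := fun i => Num.max (g i) 0) _ _ fa gc)//.
  by rewrite (esumM (f := fun i => Num.max (- f i) 0)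
    (g := fun i => Num.max (- g i) 0) _ _ fb ge).
- under eq_esum do rewrite EFinD; rewrite esumD => [|i _|i _]; rewrite ?lee_fin//.
  rewrite (esumM (f := fun i => Num.max (f i) 0)
    (g := fun i => Num.max (- g i) 0) _ _ fa ge)//.
  by rewrite (esumM (f := fun i => Num.max (- f i) 0)
    (g := fun i => Num.max (g i) 0) _ _ fb gc).
Qed.

(** Distributivity of a finite product over infinite sums, by splitting off one factor at a time; it
    turns a product over particles into a sum over labelings. *)
Lemma has_usum_tuple (I : choiceType) N (h : 'I_N -> I -> R) (s : 'I_N -> R) :
  (forall a, has_usum setT (h a) (s a)) ->
  has_usum [set: N.-tuple I] (fun L => \prod_(a < N) h a (tnth L a)) (\prod_(a < N) s a).
Proof.
elim: N h s => [|N IH] h s hs.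
  rewrite big_ord0 -[X in has_usum _ _ X]subr0.
  have e : [set: 0.-tuple I] = [set [tuple]].
    by apply/seteqP; split => // L _; rewrite [L]tuple0.
  apply: (has_usumB (g := fun=> 1) (h := fun=> 0)) => //.
  - by move=> L _; rewrite big_ord0 subr0.
  - by rewrite e esum_set1.
  - by rewrite e esum_set1.
rewrite big_ord_recl.
have := has_usumM (hs ord0) (IH _ _ (fun a => hs (lift ord0 a))).
set F := (X in has_usum _ X _) => HF.
pose e (k : I * N.-tuple I) := cons_tuple k.1 k.2.
apply: (@reindex_has_usum _ _ setT setT e).
  split=> //.
  - by move=> [x L] [y L'] _ _ /(congr1 val) /= [-> /val_inj ->].
  - by move=> L _; exists (thead L, [tuple of behead L]) => //; rewrite [RHS]tuple_eta.
apply: eq_has_usum HF => k _; rewrite big_ord_recl /F; congr (_ * _).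
by apply: eq_bigr => a _; rewrite tnthS.
Qed.

(** Both sides are sums over the pairs formed by an index in [D] and a point of its fiber. *)
Lemma esum_fiber (I J : choiceType) (D : set I) (phi : J -> I) (F : J -> R) :
  (forall j, 0 <= F j) ->
  (forall n, D n -> finite_set [set j | phi j = n]) ->
  (\esum_(n in D) (\sum_(j \in [set j | phi j = n]) F j)%:E
   = \esum_(j in phi @^-1` D) (F j)%:E)%E.
Proof.
move=> F0 fin.
rewrite (@reindex_esum _ _ _ (D `*`` (fun n => [set j | phi j = n])) _ snd).
  rewrite -(esum_esum (a := fun _ j => (F j)%:E)) => [|n j _ _]; last first.
    by rewrite lee_fin.
  apply: eq_esum => n Dn; rewrite esum_fset; last 2 first.
  - exact: fin.
  - by move=> j _; rewrite lee_fin.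
  by rewrite !fsbig_finite/= ?sumEFin//; exact: fin.
split.
- by move=> [n j] [/= Dn jn]; rewrite /preimage/= jn.
- by move=> [n j] [m i]; rewrite !inE => -[/= _ <-] [/= _ <-] ->.
- by move=> j Dj; exists (phi j, j).
Qed.

Lemma has_usum_fiber (I J : choiceType) (D : set I) (phi : J -> I) (f : I -> R)
    (F : J -> R) s :
  (forall n, D n -> finite_set [set j | phi j = n]) ->
  (forall n, D n -> f n = \sum_(j \in [set j | phi j = n]) F j) ->
  has_usum (phi @^-1` D) F s -> has_usum D f s.
Proof.
move=> fin fF /has_usum_posneg [a [b [fa fb ->]]].
have m0 (x : R) : 0 <= Num.max x 0 by rewrite le_max lexx orbT.
apply: (has_usumB (g := fun n => \sum_(j \in [set j | phi j = n]) Num.max (F j) 0)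
  (h := fun n => \sum_(j \in [set j | phi j = n]) Num.max (- F j) 0)).
- move=> n Dn; rewrite fF// !fsbig_finite/=; try exact: fin.
  by rewrite -sumrB; apply: eq_bigr => j _; exact: max_posneg.
- by move=> n _; apply: fsumr_ge0.
- by move=> n _; apply: fsumr_ge0.
- by rewrite esum_fiber.
- by rewrite esum_fiber.
Qed.

Lemma has_usum_rem (I : choiceType) (D : set I) (f : I -> R) s n :
  D n -> has_usum D f s -> has_usum (D `\ n) f (s - f n).
Proof.
move=> Dn /has_usum_posneg [a [b [fa fb ->]]].
have m0 (x : R) : 0 <= Num.max x 0 by rewrite le_max lexx orbT.
have e (g : I -> R) c : (forall i, 0 <= g i) -> (\esum_(i in D) (g i)%:E = c%:E)%E ->
    (\esum_(i in D `\ n) (g i)%:E = (c - g n)%:E)%E.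
  move=> g0; rewrite (esumID [set n])// => [|i _]; last by rewrite lee_fin.
  rewrite setIC (setIidl (_ : [set n] `<=` D)); last by move=> _ ->.
  rewrite esum_set1 ?lee_fin//= => /(congr1 (fun x => x - (g n)%:E)%E).
  by rewrite addeAC subee// add0e EFinB => <-.
have -> : a - b - f n = (a - Num.max (f n) 0) - (b - Num.max (- f n) 0).
  by rewrite {1}[f n]max_posneg; ring.
by apply: has_usumB (e _ _ _ fa) (e _ _ _ fb) => // i _; exact: max_posneg.
Qed.

End UnorderedSums.

(** * Discrete spectrum and stationary distribution *)

Section DiscreteSpectrum.
Context {R : realType} (psi : probability (measurableTypeR R) R) (zeta : nat -> R).
Hypothesis hzeta : discrete_spectrum psi zeta.
Local Notation TR := (measurableTypeR R).

Lemma atom_fin (a : R) : psi [set a] = (atom psi a)%:E.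
Proof. by rewrite /atom fineK// fin_num_measure. Qed.

Lemma integral_atom (f : TR -> R) (a : R) :
  (\int[psi]_(z in [set a]) (f z)%:E = (f a * atom psi a)%:E)%E.
Proof.
rewrite (eq_integral (fun=> (f a)%:E)) => [|z]; last by rewrite inE => ->.
by rewrite integral_cst// EFinM -atom_fin.
Qed.

(** The complement of the range of [zeta] is null, and the range is a countable disjoint union of
    points. *)
Lemma ge0_integral_atoms (f : TR -> R) : measurable_fun setT f ->
  (forall z, 0 <= f z) ->
  (\int[psi]_z (f z)%:E = \esum_(l in [set: nat]) (f (zeta l) * atom psi (zeta l))%:E)%E.
Proof.
move=> mf f0; have [inj _ _ supp] := hzeta.
have rE : range zeta = \bigcup_l [set zeta l].
  by apply/seteqP; split => [_ [l _ <-]|_ [l _ ->]]; exists l.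
have mr : measurable (range zeta : set TR).
  by rewrite rE; apply: bigcup_measurable => l _; exact: measurable_set1.
have mfE : measurable_fun setT (EFin \o f) by exact/measurable_EFinP.
have mN : measurable (~` (range zeta : set TR)) by exact: measurableC.
have psiN : psi (~` (range zeta : set TR)) = 0%E.
  by rewrite probability_setC//= supp subee.
rewrite (ge0_negligible_integral mN measurableT mfE _ psiN) => [|z _]; last first.
  by rewrite lee_fin.
rewrite setTD setCK rE ge0_integral_bigcup//.
- rewrite nneseries_esumT => [|l]; last by apply: integral_ge0 => z _; rewrite lee_fin.
  by apply: eq_esum => l _; exact: integral_atom.
- exact: measurable_funTS.
- by move=> z _; rewrite lee_fin.
- by move=> l m _ _ [z [/= -> /inj]].
Qed.

Lemma has_usum_atoms (f : TR -> R) : psi.-integrable setT (EFin \o f) ->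
  has_usum setT (fun l => f (zeta l) * atom psi (zeta l)) (Rintegral psi setT f).
Proof.
move=> fi; have mf : measurable_fun setT f.
  by apply/measurable_EFinP; exact: measurable_int fi.
have mp : measurable_fun setT (fun z => Num.max (f z) 0).
  exact: measurable_maxr.
have mn : measurable_fun setT (fun z => Num.max (- f z) 0).
  by apply: measurable_maxr => //; exact: measurableT_comp.
have m0 (x : R) : 0 <= Num.max x 0 by rewrite le_max lexx orbT.
have fp : (\int[psi]_z (Num.max (f z) 0)%:E)%E \is a fin_num.
  rewrite (eq_integral ((EFin \o f)^\+)%E) => [|z _].
    exact/integrable_fin_num/integrable_funepos.
  by rewrite funeposE /= EFin_max.
have fn : (\int[psi]_z (Num.max (- f z) 0)%:E)%E \is a fin_num.
  rewrite (eq_integral ((EFin \o f)^\-)%E) => [|z _].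
    exact/integrable_fin_num/integrable_funeneg.
  by rewrite funenegE /= EFin_max.
have -> : Rintegral psi setT f =
    fine (\int[psi]_z (Num.max (f z) 0)%:E) - fine (\int[psi]_z (Num.max (- f z) 0)%:E).
  rewrite -fineB// /Rintegral integralE; congr (fine (_ - _)%E);
    by apply: eq_integral => z _; rewrite ?funeposE ?funenegE /= EFin_max.
have a0 l : 0 <= atom psi (zeta l) by exact/fine_ge0.
apply: has_usumB.
- by move=> l _; rewrite {1}[f _]max_posneg mulrBl.
- by move=> l _; rewrite mulr_ge0.
- by move=> l _; rewrite mulr_ge0.
- by rewrite fineK// ge0_integral_atoms.
- by rewrite fineK// (ge0_integral_atoms mn).
Qed.

End DiscreteSpectrum.

(** * Spectral sums, long-time limits and the stationary distribution *)

Section Stationary.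
Context {R : realType} (lambda mu : nat -> R) (p : nat -> nat -> R -> R).
Context (Q : nat -> {poly R}) (psi : probability (measurableTypeR R) R).
Hypothesis hp : transition_function p.
Hypothesis hpsi : spectral_measure lambda mu p Q psi.
Local Notation TR := (measurableTypeR R).
Local Notation D := (`[0%R, +oo[%classic : set TR).
Local Notation pi := (pi_coef lambda mu).

Lemma spectral_usum zeta i j t : discrete_spectrum psi zeta -> 0 <= t -> 0 < pi j ->
  has_usum setT (fun l => expR (- (zeta l * t)) * ((Q i).[zeta l] * (Q j).[zeta l]
    * atom psi (zeta l))) (p i j t / pi j).
Proof.
move=> hz t0 pij; have [fi pE] := hpsi.2 i j t t0.
pose f (z : R) := expR (- (z * t)) * qfun Q i z * qfun Q j z.
have mf : measurable_fun [set: TR] f.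
  suff : measurable_fun [set: R] f by [].
  apply: measurable_funM; last exact: measurable_qfun.
  apply: measurable_funM; last exact: measurable_qfun.
  by do 2?[apply: measurableT_comp => //]; exact: measurable_funM.
have -> : p i j t / pi j = Rintegral psi setT f.
  rewrite /Rintegral (psi_integral hpsi mf fi).
  apply: (mulfI (lt0r_neq0 pij)); rewrite mulrC divfK ?gt_eqF//.
  apply: EFin_inj; rewrite pE EFinM fineK//.
  by apply: integrable_fin_num fi.
apply: eq_has_usum (has_usum_atoms hz (psi_integrable hpsi mf fi)) => l _.
by rewrite /f -!mulrA.
Qed.

(** [damp z ^+ n] lies in [0, 1] and tends to the indicator of 0, while the product of the two
    polynomials is integrable by the representation at time 0; dominated convergence leaves the mass
    at 0. *)
Lemma transition_limit i j :
  p i j n%:R @[n --> \oo] --> pi j * ((Q i).[0] * (Q j).[0] * atom psi 0).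
Proof.
rewrite (_ : (fun n => p i j n%:R) = (fun n : nat => pi j *
    Rintegral psi setT (fun z : TR => damp z ^+ n * qfun Q i z * qfun Q j z))); last first.
  by apply/funext => n; have [] := damp_spectral hpsi i j n.
apply: cvgMr.
pose F n (z : TR) := (damp z ^+ n * qfun Q i z * qfun Q j z)%:E.
have mF n : measurable_fun setT (F n).
  by have [+ _] := damp_spectral hpsi i j n; exact: measurable_int.
have q_int : psi.-integrable setT (fun z => `|(qfun Q i z * qfun Q j z)%:E|)%E.
  apply: integrable_abse; have [+ _] := damp_spectral hpsi i j 0.
  by apply: eq_integrable => // z _; rewrite expr0 mul1r.
rewrite -(Rintegral_atom psi (fun z => qfun Q i z * qfun Q j z)).
have fin : (\int[psi]_z ((z == 0)%R%:R * (qfun Q i z * qfun Q j z))%:E)%E \is a fin_num.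
  apply: integrable_fin_num => //; apply: le_integrable q_int => //.
    have mz : measurable_fun [set: TR] (fun z : TR => (z == 0 :> R)%:R : R).
      rewrite (_ : (fun _ => _) = \1_[set 0]); first exact: measurable_indic.
      by apply/funext => z; rewrite indic_set1.
    apply/measurable_EFinP; apply: measurable_funM => //.
    by apply: measurable_funM; exact: measurable_qfun.
  move=> z _; rewrite /= normr_id lee_fin normrM ler_piMl//.
  by rewrite ger0_norm// lern1 leq_b1.
apply: (@fine_cvg _ _ _ _ (fun n => \int[psi]_z F n z)%E).
rewrite /Rintegral fineK//.
apply: (@dominated_cvg _ _ _ psi setT measurableT F _
  (fun z => `|(qfun Q i z * qfun Q j z)%:E|)%E) => //.
- move=> z _; apply: cvg_EFin; first exact: nearW.
  rewrite /F/=; under eq_fun do rewrite -mulrA.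
  apply: cvgMl; have [->|z0] := eqVneq (z : R) 0.
    rewrite /damp lexx oppr0 expR0 mul1r; apply: cvg_near_cst.
    by apply: nearW => n; rewrite expr1n.
  apply: (@cvg_expr _ (damp z)); rewrite ger0_norm ?damp_ge0//.
  rewrite /damp; case: (lerP 0 (z : R)) => z1; last by rewrite mul0r.
  by rewrite mul1r expR_lt1 oppr_lt0 lt_neqAle eq_sym z0.
- move=> n z _; rewrite /F /= lee_fin -mulrA normrM ler_piMl//.
  by rewrite normrX exprn_ile1// ger0_norm ?damp_ge0 ?damp_le1.
Qed.

(** Time tends to infinity in the stationarity equation, where the limit of [p i j] does not depend
    on [i]. The sum being infinite, the limit is taken on the first [M] terms with the tail of [ps]
    as error, and then [M] tends to infinity. *)
Lemma stationary_limit ps (pi_gt0 : forall j, 0 < pi j) :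
  (forall i, (Q i).[0] = 1) -> stationary_distribution p ps ->
  forall j, ps j = pi j * atom psi 0.
Proof.
move=> Q1 [ps0 ps1 psE] j; have [p0 _ p1 _] := hp.
have lim i : p i j n%:R @[n --> \oo] --> pi j * atom psi 0.
  by have := @transition_limit i j; rewrite !Q1 !mul1r.
have p_le1 i n : p i j n%:R <= 1.
  rewrite -lee_fin -(p1 i n%:R (ler0n _ _)).
  have := @nneseries_lim_ge _ (fun j => (p i j n%:R)%:E) xpredT 0 j.+1.
  move=> /(_ (fun j _ _ => p0 _ _ _ (ler0n _ _))); apply: le_trans.
  by rewrite big_nat_recr//= leeDr// sume_ge0// => k _; rewrite lee_fin p0.
have S1 := nneseries_cvg ps0 ps1.
have Sj n := nneseries_cvg (fun i => mulr_ge0 (ps0 i) (p0 i j _ (ler0n _ n)))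
  (psE j n%:R (ler0n _ n)).
set c := pi j * atom psi 0 in lim *.
have limM M : \sum_(i < M) ps i * p i j n%:R @[n --> \oo] --> \sum_(i < M) ps i * c.
  apply: cvg_big => [|i _]; first exact: add_continuous.
  by apply: cvgMr; exact: lim.
have partial (f : nat -> R) s M : (forall i, 0 <= f i) ->
    \sum_(i < K) f i @[K --> \oo] --> s -> \sum_(i < M) f i <= s.
  move=> f0 fs; apply: (ler_cvg_to (cvg_cst _) fs); exists M => // K /= MK.
  rewrite -!(big_mkord xpredT) (big_cat_nat _ MK)//= lerDl.
  by apply: sumr_ge0.
have lower M : \sum_(i < M) ps i * c <= ps j.
  apply: (ler_cvg_to (limM M) (cvg_cst _)); apply: nearW => n.
  by apply: (partial (fun i => ps i * p i j n%:R) _ M _ (Sj n)) => i; rewrite mulr_ge0 ?p0.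
(* The terms [ps i * (1 - p i j n%:R)] are nonnegative with total [1 - ps j], which bounds their
   partial sums. *)
have upper M : ps j <= \sum_(i < M) ps i * c + (1 - \sum_(i < M) ps i).
  apply: (ler_cvg_to (cvg_cst _) (cvgD (limM M) (cvg_cst _))); apply: nearW => n.
  have fE K : \sum_(i < K) ps i * (1 - p i j n%:R) =
      \sum_(i < K) ps i - \sum_(i < K) ps i * p i j n%:R.
    by rewrite -sumrB; apply: eq_bigr => i _; rewrite mulrBr mulr1.
  have : \sum_(i < M) ps i * (1 - p i j n%:R) <= 1 - ps j.
    apply: (partial (fun i => ps i * (1 - p i j n%:R))) => [i|].
      by rewrite mulr_ge0// subr_ge0 p_le1.
    by under eq_fun do rewrite fE; exact: cvgB S1 (Sj n).
  rewrite fE -[X in _ -> _ <= X]/(\sum_(i < M) ps i * p i j n%:R + (1 - \sum_(i < M) ps i)).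
  by lra.
have limc : \sum_(i < M) ps i * c @[M --> \oo] --> c.
  rewrite -[X in _ --> X]mul1r; under eq_fun do rewrite -mulr_suml.
  exact: cvgMl.
apply/eqP; rewrite eq_le; apply/andP; split.
  rewrite -[leRHS]addr0 -(subrr (1 : R)).
  apply: (ler_cvg_to (cvg_cst _) (cvgD limc (cvgB (cvg_cst _) S1))).
  exact: nearW.
by apply: (ler_cvg_to limc (cvg_cst _)); exact: nearW.
Qed.

End Stationary.

(** * Krawtchouk polynomials as sums over labelings *)

Section LabelCounts.

(* Label 0 is not recorded: its count n_0 is determined by the length of the list. *)
Definition multi_index (L : seq nat) : config :=
  [fsfun i in [fset i | i in L]%fset => if i == 0%N then 0%N else count_mem i L | 0%N].

Lemma multi_indexE L i : multi_index L i = if i == 0%N then 0%N else count_mem i L.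
Proof.
rewrite fsfun_fun in_fset /=; case: ifPn => // iL.
by case: eqP => // _; apply/esym/count_memPn.
Qed.

Lemma finsupp_undup (x : config) (s : seq nat) : (forall i, x i = count_mem i s) ->
  perm_eq (finsupp x) (undup s).
Proof.
move=> xs; apply: uniq_perm; rewrite ?undup_uniq ?fset_uniq// => i.
by rewrite mem_undup mem_finsupp xs -lt0n -has_count has_pred1.
Qed.

Lemma ctotal_count (x : config) (s : seq nat) :
  (forall i, x i = count_mem i s) -> ctotal x = size s.
Proof.
move=> xs; rewrite /ctotal -sum1_size -[RHS]big_undup_iterop_count/=.
rewrite (perm_big _ (finsupp_undup xs))/=; apply: eq_bigr => i _.
by rewrite xs; elim: (count_mem i s) => //= -[|m] //= ->; rewrite add1n.
Qed.

Lemma multi_index_count L i :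
  multi_index L i = count_mem i [seq l <- L | l != 0%N].
Proof.
rewrite multi_indexE count_filter; case: eqP => [->|/eqP i0].
  by rewrite (eq_count (a2 := pred0)) ?count_pred0// => l /=; case: eqP.
by apply: eq_count => l /=; case: eqP => // ->.
Qed.

Lemma ctotal_multi_index L : ctotal (multi_index L) = count (predC1 0%N) L.
Proof. by rewrite (ctotal_count (multi_index_count L)) size_filter. Qed.

Lemma count0 L : (count_mem 0%N L = size L - ctotal (multi_index L))%N.
Proof. by rewrite ctotal_multi_index -(count_predC (pred1 0%N) L) addnK. Qed.

(** The unrecorded count of label 0 is recovered from the common length. *)
Lemma multi_index_perm L M : size L = size M -> multi_index L = multi_index M ->
  perm_eq L M.
Proof.
move=> sLM mLM; apply/allP => i _ /=; have [->|i0] := eqVneq i 0%N.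
  by rewrite !count0 sLM mLM.
have /(congr1 (fun n : config => n i)) := mLM.
by rewrite !multi_indexE (negbTE i0) => ->.
Qed.

Lemma perm_multi_index L M : perm_eq L M -> multi_index L = multi_index M.
Proof. by move=> /seq.permP LM; apply/fsfunP => i; rewrite !multi_indexE LM. Qed.

Lemma multi_index_cat L M i : multi_index (L ++ M) i = (multi_index L i + multi_index M i)%N.
Proof. by rewrite !multi_indexE; case: eqP; rewrite ?count_cat. Qed.

Definition labelings (k : nat) (n : config) : set (seq nat) :=
  [set L | size L = k /\ multi_index L = n].

Lemma labelingsE L : labelings (size L) (multi_index L) = [set` permutations L].
Proof.
apply/seteqP; split => M /=; rewrite mem_permutations.
  by move=> [sM mM]; apply: multi_index_perm.
by move=> ML; rewrite /labelings/= (perm_size ML) (perm_multi_index ML).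
Qed.

Lemma finite_labelings k n : finite_set (labelings k n).
Proof.
have [->|/set0P [L [<- <-]]] := eqVneq (labelings k n) set0; first exact: finite_set0.
by rewrite labelingsE; exact: finite_seq.
Qed.

(** A reference assignment of states to particles with counts [x]; every other one is a
    rearrangement of it. *)
Definition config_list (x : config) : seq nat :=
  flatten [seq nseq (x j) j | j <- finsupp x].

Lemma count_config_list x i : count_mem i (config_list x) = x i.
Proof.
rewrite /config_list count_flatten -map_comp.
under eq_map do rewrite /= count_nseq/=.
have [xi|xi] := boolP (i \in finsupp x).
  rewrite sumnE big_map (bigD1_seq i) ?fset_uniq//= eqxx mul1n big1 ?addn0// => j ji.
  by rewrite (negbTE ji).
rewrite sumnE big_map big1_seq => [|j /andP[_ xj]].
  by apply/esym/eqP; rewrite -memNfinsupp.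
by case: eqP => [ji|]; rewrite ?mul0n//; rewrite -ji xj in xi.
Qed.

Lemma size_config_list x : size (config_list x) = ctotal x.
Proof. by rewrite (ctotal_count (s := config_list x))// => i; rewrite count_config_list. Qed.

(** The nonzero labels are listed with multiplicity, and zeros pad the list to length [N]. *)
Lemma multi_index_surj N (n : config) : n 0%N = 0%N -> (ctotal n <= N)%N ->
  exists2 L, size L = N & multi_index L = n.
Proof.
move=> n0 nN; exists (config_list n ++ nseq (N - ctotal n) 0%N).
  by rewrite size_cat size_config_list size_nseq subnKC.
apply/fsfunP => i; rewrite multi_indexE count_cat count_config_list count_nseq/=.
by case: eqP => [->//|/eqP]; rewrite eq_sym => /negbTE ->; rewrite mul0n addn0.
Qed.

Lemma multi_index0 L : multi_index L 0%N = 0%N.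
Proof. by rewrite multi_indexE. Qed.

Lemma full_index_count L i : full_index (size L) (multi_index L) i = count_mem i L.
Proof.
rewrite fsfun_fun in_fsetU in_fset1 mem_finsupp multi_indexE.
by case: eqP => [->|_] /=; [rewrite count0|case: eqP].
Qed.

End LabelCounts.

Lemma fsbig_partition {R : realType} {I J : choiceType} (X : set J) (phi : J -> I)
    (f : J -> R) : finite_set X ->
  \sum_(j \in X) f j =
  \sum_(i \in phi @` X) \sum_(j \in X `&` [set j | phi j = i]) f j.
Proof.
move=> fX; have fA := finite_image phi fX.
have e i : \sum_(j \in X `&` [set j | phi j = i]) f j =
    \sum_(j \in X) if phi j == i then f j else 0.
  rewrite fsbig_mkcondr; apply: eq_fsbigr => j _.
  by congr (if _ then _ else _); apply/idP/eqP; rewrite inE.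
transitivity (\sum_(i \in phi @` X) \sum_(j \in X) if phi j == i then f j else 0).
  2: by apply: eq_fsbigr => i _; exact/esym/e.
rewrite exchange_fsbig//; apply: eq_fsbigr => j; rewrite inE => Xj.
rewrite (fsbigD1 (phi j))//=; last by exists j.
rewrite eqxx fsbig1 ?addr0// => i [_ /= ij]; rewrite ifF//.
by apply/eqP => /esym.
Qed.

Section KrawtchoukExpansion.
Context {R : realType} (u : nat -> nat -> R).

Definition labeling_weight (L s : seq nat) : R :=
  \prod_(z <- zip L s) u z.1 z.2.

(** The expansion of a product of linear series by one choice per particle: [s] lists the states,
    [L] the chosen variables, and label 0 stands for the constant term. *)
Definition labeling_series (F : fps) (s : seq nat) :=
  forall n, F n = \sum_(L \in labelings (size s) n) labeling_weight L s.

Lemma labeling_series_one : labeling_series fps_one [::].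
Proof.
move=> n; rewrite /fps_one; case: eqP => [n0|n0].
  have -> : labelings (size ([::] : seq nat)) n = [set [::]].
    apply/seteqP; split => [L [/size0nil -> //]|_ ->]; split=> //.
    apply/fsfunP => i; rewrite -(count_config_list n).
    move: (size_config_list n); rewrite n0 => /size0nil ->.
    by rewrite multi_indexE; case: eqP.
  by rewrite fsbig_set1 /labeling_weight big_nil.
rewrite fsbig1// => L [/size0nil -> mn]; case: n0; rewrite -mn.
by rewrite ctotal_multi_index.
Qed.

Lemma labeling_series_linear j : labeling_series (linear_series u j) [:: j].
Proof.
move=> n /=.
have lab1 l : labelings 1 (multi_index [:: l]) = [set [:: l]].
  apply/seteqP; split => [M [sM mM]|_ -> //].
  by apply: perm_small_eq => //; apply: multi_index_perm.
have sum1 l : \sum_(L \in labelings 1 (multi_index [:: l])) labeling_weight L [:: j] = u l j.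
  by rewrite lab1 fsbig_set1 /labeling_weight big_seq1.
have e0 : ctotal n = 0%N -> n = multi_index [:: 0%N].
  move=> n0; move: (size_config_list n); rewrite n0 => /size0nil ln.
  by apply/fsfunP => i; rewrite -(count_config_list n) ln multi_indexE; case: i.
rewrite /linear_series; case: eqP => [/e0 ->|n0]; first by rewrite sum1.
case: eqP => [n1|n1].
  move: (size_config_list n); rewrite n1.
  case: (config_list n) (count_config_list n) => [//|l [|//]] cl _.
  have supp : perm_eq (finsupp n) [:: l].
    apply: uniq_perm; rewrite ?fset_uniq// => i.
    by rewrite mem_finsupp -cl/= addn0 inE (eq_sym i); case: (l == i).
  rewrite (perm_big _ supp)/= big_mkcond big_seq1; case: ltnP => [l0|].
    rewrite -sum1; apply: eq_fsbigl; congr labelings; apply/fsfunP => i.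
    by rewrite multi_indexE -cl/=; case: eqP => // ->; rewrite gtn_eqF.
  (* A unit placed at index 0 comes from no labeling, since [multi_index] vanishes there; the filter
     in [linear_series] makes the other side 0 too. *)
  rewrite leqn0 => /eqP l0; rewrite fsbig1// => M [_ mM].
  by have := multi_index0 M; rewrite mM -cl/= l0.
rewrite fsbig1// => -[|l [|l' L]] []//= _ mn; exfalso.
move: n0 n1; rewrite -mn ctotal_multi_index/= addn0; by case: (l == 0%N).
Qed.

(** A labeling of [s ++ t] is cut into one of [s] and one of [t]; grouping these pairs by their two
    multi-indices reproduces the convolution. *)
Lemma labeling_series_mul F G s t : labeling_series F s -> labeling_series G t ->
  labeling_series (fps_mul F G) (s ++ t).
Proof.
move=> Fs Gt n; rewrite /fps_mul.
pose X := [set LM : seq nat * seq nat | [/\ size LM.1 = size s, size LM.2 = size t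
  & forall i, (multi_index LM.1 i + multi_index LM.2 i)%N = n i]].
have bij : set_bij (labelings (size (s ++ t)) n) X
    (fun L => (take (size s) L, drop (size s) L)).
  split.
  - move=> L [sL mL]; rewrite /X/= size_take size_drop sL size_cat.
    split; rewrite ?addKn//.
      by case: ltnP => //; rewrite -[leqRHS]addn0 leq_add2l leqn0 => /eqP ->; rewrite addn0.
    by move=> i; rewrite -multi_index_cat cat_take_drop mL.
  - by move=> L M _ _ [e1 e2]; rewrite -(cat_take_drop (size s) L) e1 e2 cat_take_drop.
  - move=> [L M] [/= sL sM mLM]; exists (L ++ M).
      split; first by rewrite !size_cat sL sM.
      by apply/fsfunP => i; rewrite multi_index_cat mLM.
    by rewrite /= -sL take_size_cat ?drop_size_cat.
have fX : finite_set X.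
  have := finite_image (fun L => (take (size s) L, drop (size s) L))
    (finite_labelings (size (s ++ t)) n).
  by apply: sub_finite_set; have [_ _] := bij.
rewrite [RHS](_ : _ = \sum_(LM \in X)
    labeling_weight LM.1 s * labeling_weight LM.2 t); last first.
  rewrite [RHS](reindex_fsbig _ _ _ _ bij); apply: eq_fsbigr => L; rewrite inE => -[sL _].

  rewrite /labeling_weight -big_cat -zip_cat ?cat_take_drop//= size_take sL size_cat.
  by case: ltnP => //; rewrite -[leqRHS]addn0 leq_add2l leqn0 => /eqP ->; rewrite addn0.
pose phi (LM : seq nat * seq nat) := (multi_index LM.1, multi_index LM.2).
rewrite (fsbig_partition phi)//.
(* Pairs of configurations realized by no labelings add 0 to the convolution, one of their two
   coefficients being an empty sum. *)
rewrite -(@fsbig_widen _ _ _ _ (phi @` X)).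
- apply: eq_fsbigr => -[a b]; rewrite inE => -[[L M] [/= sL sM mLM] [La Mb]].
  rewrite Fs Gt mulr_fsuml; under eq_fsbigr do rewrite mulr_fsumr.
  rewrite pair_fsbig//=; try exact: finite_labelings.
  apply: eq_fsbigl; apply/seteqP; split => -[L' M'] /=.
    move=> [[sL' mL'] [sM' mM']]; split; last by rewrite /phi/= mL' mM'.
    by split => // i; rewrite mL' mM' -La -Mb mLM.
  by move=> [[/= sL' sM' _] [<- <-]].
- by move=> _ [[L M] [/= sL sM mLM] <-].
- move=> [a b] [/= ab nX].
  have [//|] := eqVneq (F a * G b) 0.
  have nonempty k m (w : seq nat -> R) :
      \sum_(L \in labelings k m) w L != 0 -> exists L, labelings k m L.
    by apply: contra_neqP => /forallNP h; rewrite fsbig1// => L /h.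
  rewrite mulf_eq0 negb_or Fs Gt => /andP[/nonempty[L [sL mL]] /nonempty[M [sM mM]]].
  by case: nX; exists (L, M); rewrite /phi/= ?mL ?mM//; split => //= i; rewrite mL mM.
Qed.

Lemma labeling_series_exp j k :
  labeling_series (fps_exp (linear_series u j) k) (nseq k j).
Proof.
elim: k => [|k IH]; first exact: labeling_series_one.
by have := labeling_series_mul (labeling_series_linear j) IH.
Qed.

(** The generating product is multiplied out along [config_list x], where state [j] is repeated
    [x j] times. *)
Lemma krawtchouk_labelings n x :
  krawtchouk u n x =
  \sum_(L \in labelings (ctotal x) n) labeling_weight L (config_list x).
Proof.
rewrite -size_config_list; move: n; rewrite /krawtchouk /config_list.
elim: (enum_fset (finsupp x)) => [|j r IH].
  by rewrite big_nil; exact: labeling_series_one.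
by rewrite big_cons; exact: labeling_series_mul (labeling_series_exp _ _) IH.
Qed.

End KrawtchoukExpansion.

(** * Counting arrangements and summing over permutations *)

Section Permutations.

(** Induction on the length through the first letter: arrangements starting with [x] are those of
    [rem x s], and the counts of the letters add up to the length. Letting [D] be larger than the
    support keeps it fixed as letters are removed. *)
Lemma size_permutations_fact (s D : seq nat) : uniq D -> {subset s <= D} ->
  (size (permutations s) * \prod_(i <- D) (count_mem i s)`! = (size s)`!)%N.
Proof.
move=> uD; have [n] := ubnP (size s); elim: n s => // n IH s; rewrite ltnS => sn sD.
have [->|s0] := eqVneq s [::].
  by rewrite big1_seq.
rewrite (perm_size (permutationsE _)) ?lt0n ?size_eq0//.
rewrite size_flatten /shape -map_comp sumnE big_map big_distrl/=.
have rem_eq x : x \in s -> (size [seq x :: t | t <- permutations (rem x s)] *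
    \prod_(i <- D) (count_mem i s)`! = count_mem x s * (size s).-1`!)%N.
  move=> xs; rewrite size_map (bigD1_seq x)/= ?(sD _ xs)//.
  have cx : count_mem x s = (count_mem x (rem x s)).+1.
    by rewrite (seq.permP (perm_to_rem xs)) /= eqxx.
  rewrite cx factS -(size_rem xs) -(IH (rem x s)).
  - rewrite [in RHS](bigD1_seq x)/= ?(sD _ xs)//.
    rewrite [X in (_ * (_ * X))%N = _](eq_bigr (fun i => (count_mem i (rem x s))`!)).
      by rewrite -!mulnA; ring.
    by move=> i ix; rewrite (seq.permP (perm_to_rem xs)) /= eq_sym (negbTE ix).
  - by rewrite size_rem// prednK ?(leq_trans _ sn)// lt0n size_eq0.
  - by move=> i /mem_rem /sD.
rewrite (eq_big_seq (fun x => count_mem x s * (size s).-1`!)%N); last first.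
  by move=> x; rewrite mem_undup => /rem_eq.
have -> : (\sum_(i <- undup s) count_mem i s * (size s).-1`! = size s * (size s).-1`!)%N.
  rewrite -big_distrl/=; congr (_ * _)%N.
  rewrite -[RHS]sum1_size -[RHS]big_undup_iterop_count/=; apply: eq_bigr => i _.
  by elim: (count_mem i s) => //= -[|m] //= ->; rewrite add1n.
by case: s s0 {sn sD rem_eq} => // x s _; rewrite -factS.
Qed.

Lemma multinomial_permutations {R : realType} (s : seq nat) (x : config) :
  (forall i, x i = count_mem i s) ->
  multinomial (size s) x = (size (permutations s))%:R :> R.
Proof.
move=> xs; rewrite /multinomial; under [X in _ / X%:R]eq_bigr do rewrite xs.
rewrite -(@size_permutations_fact s (finsupp x)).
- rewrite natrM mulfK// pnatr_eq0 -lt0n.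
  by apply: prodn_gt0 => i; exact: fact_gt0.
- exact: fset_uniq.
- by move=> i is_; rewrite mem_finsupp xs -lt0n -has_count has_pred1.
Qed.

Definition permute {T : Type} {N} (t : N.-tuple T) (sigma : 'S_N) : N.-tuple T :=
  [tuple tnth t (sigma i) | i < N].

(** Every distinct arrangement comes from equally many permutations; cross-multiplication eliminates
    that number instead of computing it. *)
Lemma sum_permute {R : realType} {N} (t : N.-tuple nat) (F : seq nat -> R) :
  (size (permutations t))%:R * \sum_(sigma : 'S_N) F (permute t sigma) =
  N`!%:R * \sum_(s <- permutations t) F s.
Proof.
pose c := #|[pred sigma | permute t sigma == t]|.
have fiber s : s \in permutations t ->
    #|[pred sigma : 'S_N | tval (permute t sigma) == s]| = c.
  rewrite mem_permutations => /tuple_permP[q ->].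
  (* Left multiplication by [q] carries the fiber over [t] to the fiber over its arrangement by
     [q]. *)
  rewrite /c -!sum1_card (reindex_inj (mulgI q)); apply: eq_bigl => sigma.
  rewrite !inE (inj_eq val_inj); apply/eqP/eqP => h; apply: eq_from_tnth => i.
    have /(congr1 (fun u => tnth u (q^-1%g i))) := h.
    by rewrite !tnth_mktuple permM permKV.
  by have /(congr1 (fun u => tnth u (q i))) := h; rewrite !tnth_mktuple permM.
have sumE (G : seq nat -> R) : \sum_(sigma : 'S_N) G (permute t sigma) =
    c%:R * \sum_(s <- permutations t) G s.
  transitivity (\sum_(sigma : 'S_N) \sum_(s <- permutations t)
      if tval (permute t sigma) == s then G s else 0).
    apply: eq_bigr => sigma _; rewrite (bigD1_seq (tval (permute t sigma)))/=.
    - by rewrite eqxx big1 ?addr0// => s; rewrite eq_sym => /negbTE ->.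
    - by rewrite mem_permutations; apply/tuple_permP; exists sigma.
    - exact: permutations_uniq.
  rewrite exchange_big mulr_sumr; apply: eq_big_seq => s /fiber <-.
  by rewrite -big_mkcond/= sumr_const mulr_natl.
(* The constant function 1 shows that the fiber size [c] times the number of arrangements is the
   factorial of [N]. *)
have := sumE (fun=> 1); rewrite sumr_const card_Sn big_const_seq count_predT iter_addr_0.
by rewrite !sumE => ->; rewrite mulrCA mulrA.
Qed.

End Permutations.

(** * Bilinear sums of Krawtchouk polynomials as permanents *)

Section KrawtchoukSum.
Context {R : realType}.

Definition permanent {N} (B : nat -> nat -> R) (X Y : N.-tuple nat) : R :=
  \sum_(sigma : 'S_N) \prod_(a < N) B (tnth X a) (tnth Y (sigma a)).

Lemma prod_permute {N} (c : nat -> nat -> R) (L X : N.-tuple nat) (sigma : 'S_N) :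
  \prod_(a < N) c (tnth (permute L sigma) a) (tnth X a) =
  \prod_(a < N) c (tnth L a) (tnth (permute X sigma^-1) a).
Proof.
rewrite (reindex_inj (@perm_inj _ sigma^-1)); apply: eq_bigr => a _.
by rewrite !tnth_mktuple permKV.
Qed.

Lemma permanent_permute {N} B (X Y : N.-tuple nat) sigma :
  permanent B (permute X sigma) Y = permanent B X Y.
Proof.
rewrite /permanent (reindex_inj (mulgI sigma)); apply: eq_bigr => tau _.
rewrite [RHS](reindex_inj (@perm_inj _ sigma)); apply: eq_bigr => a _.
by rewrite tnth_mktuple permM.
Qed.

Lemma labeling_weight_tuple {N} u (L X : N.-tuple nat) :
  labeling_weight u L X = \prod_(a < N) u (tnth L a) (tnth X a) :> R.
Proof.
rewrite /labeling_weight (big_tuple _ _ [tuple of zip L X])/=.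
apply: eq_bigr => a _.
by rewrite (tnth_nth (0, 0)%N) nth_zip ?size_tuple//= -!tnth_nth.
Qed.

(** Permuting the states amounts to permuting the labels by the inverse, and the arrangements of [L]
    are exactly the labelings with its counts. *)
Lemma krawtchouk_permute {N} u (L X : N.-tuple nat) x : tval X = config_list x ->
  (size (permutations L))%:R * \sum_(sigma : 'S_N) labeling_weight u L (permute X sigma)
  = N`!%:R * krawtchouk u (multi_index L) x :> R.
Proof.
move=> Xx; rewrite krawtchouk_labelings -size_config_list -Xx size_tuple.
have := labelingsE L; rewrite size_tuple => ->.
rewrite -fsbig_seq ?permutations_uniq//.
rewrite -sum_permute; congr (_ * _).
rewrite (reindex_inj invg_inj); apply: eq_bigr => sigma _.
by rewrite !labeling_weight_tuple prod_permute.
Qed.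

(** The permanent is averaged over permutations of both [X] and [Y], expanded over labelings, and
    collected by multi-index. If M labelings have multi-index n, each contributes E(n) Q_n(x; u)
    Q_n(y; u) / M^2, so together they leave 1 / M, the inverse multinomial coefficient. *)
Lemma krawtchouk_usum {N} (u : nat -> nat -> R) (rho : nat -> R) B (E : config -> R)
    (x y : config) (X Y : N.-tuple nat) :
  (forall i j, has_usum setT (fun l => rho l * (u l i * u l j)) (B i j)) ->
  (forall L : N.-tuple nat, E (multi_index L) = \prod_(a < N) rho (tnth L a)) ->
  tval X = config_list x -> tval Y = config_list y ->
  has_usum [set n : config | n 0%N = 0%N /\ (ctotal n <= N)%N]
    (fun n => E n * (multinomial N (full_index N n))^-1
              * krawtchouk u n x * krawtchouk u n y)
    (N`!%:R^-1 * permanent B X Y).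
Proof.
move=> hB hE Xx Yy; set D := (X in has_usum X).
have N0 : N`!%:R != 0 :> R by rewrite pnatr_eq0 -lt0n fact_gt0.
pose phi (L : N.-tuple nat) := multi_index L.
(* The contribution of a single labeling; the two inverse factorials are the averages over [sigma]
   and [tau]. *)
pose G (L : N.-tuple nat) := N`!%:R^-1 * (N`!%:R^-1 * \sum_(sigma : 'S_N) \sum_(tau : 'S_N)
  \prod_(a < N) (rho (tnth L a) *
    (u (tnth L a) (tnth (permute X sigma) a) * u (tnth L a) (tnth (permute Y tau) a)))).
have GE L : G L = E (phi L) * (size (permutations L))%:R^-1 ^+ 2
    * krawtchouk u (phi L) x * krawtchouk u (phi L) y.
  have P0 : (size (permutations L))%:R != 0 :> R.
    rewrite pnatr_eq0 size_eq0; apply/eqP => P0.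
    by have := mem_permutations L L; rewrite P0 perm_refl.
  transitivity (E (phi L)
    * (N`!%:R^-1 * \sum_(sigma : 'S_N) labeling_weight u L (permute X sigma))
    * (N`!%:R^-1 * \sum_(tau : 'S_N) labeling_weight u L (permute Y tau))).
    rewrite /G hE; set S1 := \sum_(sigma : 'S_N) labeling_weight u L (permute X sigma).
    set S2 := \sum_(tau : 'S_N) labeling_weight u L (permute Y tau).
    have -> : \sum_(sigma : 'S_N) \sum_(tau : 'S_N) \prod_(a < N) (rho (tnth L a) *
        (u (tnth L a) (tnth (permute X sigma) a) * u (tnth L a) (tnth (permute Y tau) a)))
        = (\prod_(a < N) rho (tnth L a)) * (S1 * S2).
      rewrite /S1 /S2 big_distrlr mulr_sumr; apply: eq_bigr => sigma _.
      rewrite mulr_sumr; apply: eq_bigr => tau _.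
      by rewrite !labeling_weight_tuple !big_split.
    by ring.
  have h x' (X' : N.-tuple nat) : tval X' = config_list x' ->
      N`!%:R^-1 * \sum_(sigma : 'S_N) labeling_weight u L (permute X' sigma) =
      (size (permutations L))%:R^-1 * krawtchouk u (phi L) x'.
    move=> Xx'; apply: (mulfI P0); rewrite mulrCA (krawtchouk_permute _ _ Xx').
    by rewrite mulKf// mulVKf.
  by rewrite (h _ _ Xx) (h _ _ Yy) expr2; ring.
have fiberE n : [set L | phi L = n] = @tval _ _ @^-1` labelings N n.
  by apply/seteqP; split => L /=; [move=> <-; split; rewrite ?size_tuple|case].
have fin n : finite_set [set L | phi L = n].
  rewrite fiberE; apply: finite_preimage; last exact: finite_labelings.
  by move=> L M _ _; exact: val_inj.
apply: (@has_usum_fiber _ _ _ _ phi _ G).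
- by [].
- move=> n [n0 nN]; have [L0 sL0 mL0] := multi_index_surj n0 nN.
  pose L1 := Tuple (introT eqP sL0).
  have fb : set_bij [set L | phi L = n] (labelings N n) (@tval _ _).
    split.
    - by move=> L /= <-; split; rewrite ?size_tuple.
    - by move=> L M _ _; exact: val_inj.
    - by move=> M [sM mM]; exists (Tuple (introT eqP sM)).
  have -> : \sum_(j \in [set j | phi j = n]) G j =
      \sum_(L \in labelings N n) (E n * (size (permutations L0))%:R^-1 ^+ 2
      * krawtchouk u n x * krawtchouk u n y).
    rewrite (reindex_fsbig _ _ _ _ fb); apply: eq_fsbigr => L; rewrite inE/= => Ln.
    rewrite GE Ln; congr (_ * _^-1 ^+ 2 * _ * _); congr (_%:R).
    apply/perm_size/perm_permutations/multi_index_perm.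
      by rewrite size_tuple.
    by rewrite mL0.
  rewrite -sL0 -mL0 labelingsE -fsbig_seq ?permutations_uniq//.
  rewrite big_const_seq count_predT iter_addr_0.
  rewrite (multinomial_permutations (full_index_count L0)) mL0.
  have P0 : (size (permutations L0))%:R != 0 :> R.
    rewrite pnatr_eq0 size_eq0; apply/eqP => P0.
    by have := mem_permutations L0 L0; rewrite P0 perm_refl.
  by rewrite -mulr_natr expr2; field.
have -> : phi @^-1` D = setT.
  apply/seteqP; split=> // L _; split; first exact: multi_index0.
  rewrite ctotal_multi_index; apply: leq_trans (count_size _ _) _.
  by rewrite size_tuple.
(* For fixed [sigma] the sum over [tau] is already a permanent, and it does not depend on
   [sigma]. *)
have -> : N`!%:R^-1 * permanent B X Y = N`!%:R^-1 * (N`!%:R^-1 * \sum_(sigma : 'S_N)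
    \sum_(tau : 'S_N) \prod_(a < N) B (tnth (permute X sigma) a) (tnth (permute Y tau) a)).
  congr (_ * _).
  have -> : \sum_(sigma : 'S_N) \sum_(tau : 'S_N)
      \prod_(a < N) B (tnth (permute X sigma) a) (tnth (permute Y tau) a) =
      \sum_(sigma : 'S_N) permanent B X Y.
    apply: eq_bigr => sigma _; rewrite -(permanent_permute B X Y sigma).
    by apply: eq_bigr => tau _; apply: eq_bigr => a _;
      rewrite [tnth (permute Y tau) a]tnth_mktuple.
  by rewrite sumr_const card_Sn -[permanent B X Y *+ _]mulr_natl mulKf.
apply: has_usumZ; apply: has_usumZ; apply: has_usum_sum => sigma.
apply: has_usum_sum => tau.
apply: (has_usum_tuple (h := fun a l => rho l *
  (u l (tnth (permute X sigma) a) * u l (tnth (permute Y tau) a)))) => a.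
exact: hB.
Qed.

End KrawtchoukSum.

(** * Independent processes *)

Section IndependentProcesses.
Context {R : realType} {d : measure_display} {T : measurableType d} (P : probability T R).
Context {N : nat} (lambda mu : nat -> R) (p : nat -> nat -> R -> R).
Context (xi : 'I_N -> R -> T -> nat).
Hypothesis hxi : forall k, birth_death_process P lambda mu p (xi k).
Hypothesis hind : independent_processes P xi.
Context (t : R) (t_ge0 : 0 <= t).

Definition state_event (a : 'I_N) (s : R) (i : nat) : set T := [set w | xi a s w = i].

Lemma measurable_state a s i : 0 <= s -> measurable (state_event a s i).
Proof. by move=> s0; have [_ _ [m _] _] := hxi a; exact: m. Qed.

Lemma state_sigma_algebra a s i : 0 <= s ->
  process_sigma_algebra (xi a) (state_event a s i).
Proof. by move=> s0; apply: sub_sigma_algebra; exists s, i. Qed.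

(** The Markov property with time 0 as the only past; an initial state of probability 0 makes both
    sides vanish. *)
Lemma state_transition a i j :
  fine (P (state_event a 0 i `&` state_event a t j)) =
  fine (P (state_event a 0 i)) * p i j t.
Proof.
have [_ _ [_ mk] _] := hxi a.
have := mk (fun k => if k == 0%N then 0 else t) (fun k => if k == 0%N then i else j) 0%N.
move=> /(_ (lexx _)) /= mk'.
have {}mk' := mk' _; rewrite subr0 in mk'.
set past := [set w | _] in mk'.
have pastE : past = state_event a 0 i.
  apply/seteqP; split => w /=; first by move=> /(_ 0%N (leqnn 0)).
  by move=> wi k; rewrite leqn0 => /eqP ->.
rewrite pastE in mk'.
have mi := measurable_state a i (lexx 0); have mj := measurable_state a j t_ge0.
have [P0|P0] := eqVneq (P (state_event a 0 i)) 0%E.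
  rewrite P0/= mul0r; apply: (congr1 fine (y := 0%E)).
  apply/eqP; rewrite eq_le measure_ge0 andbT -P0; apply: le_measure;
    by rewrite ?inE//; exact: measurableI.
have Pgt0 : (0 < P (state_event a 0 i))%E by rewrite lt0e P0 measure_ge0.
rewrite -mk'//; last by case=> //= k; rewrite eqxx.
rewrite /cond_prob mulrC divfK; first by rewrite setIC.
by rewrite gt_eqF// fine_gt0// Pgt0/= ltey_eq fin_num_measure.
Qed.

Definition states_event (s : R) (f : N.-tuple nat) : set T :=
  \bigcap_(a in [set: 'I_N]) state_event a s (tnth f a).

Lemma measurable_states s f : 0 <= s -> measurable (states_event s f).
Proof.
move=> s0; apply: fin_bigcap_measurable => // a _; exact: measurable_state.
Qed.

Lemma states_prob f :
  fine (P (states_event 0 f)) = \prod_(a < N) fine (P (state_event a 0 (tnth f a))).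
Proof. by apply: hind => a; exact: state_sigma_algebra. Qed.

(** Independence applies to the intersection of the initial and final events of each particle, which
    lies in the sigma-algebra of its process. *)
Lemma states_transition f h :
  fine (P (states_event 0 f `&` states_event t h)) =
  fine (P (states_event 0 f)) * \prod_(a < N) p (tnth f a) (tnth h a) t.
Proof.
rewrite states_prob -big_split/= -bigcapI hind.
  by apply: eq_bigr => a _; rewrite state_transition.
move=> a; rewrite /process_sigma_algebra; set G := (X in <<s X >>).
apply: (@measurableI _ (g_sigma_algebraType G)); exact: state_sigma_algebra.
Qed.

Lemma count_tnth (f : N.-tuple nat) k :
  count_mem k f = #|[pred j | tnth f j == k]|.
Proof.
rewrite -[in LHS](map_tnth_enum f) count_map -sum1_count big_enum_cond -sum1_card.
by apply: eq_bigl => a; rewrite inE.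
Qed.

Definition rearrangements (x : config) : set (N.-tuple nat) :=
  [set f : N.-tuple nat | perm_eq f (config_list x)].

Lemma counts_eventE s x : ctotal x = N ->
  counts_event xi s x = \bigcup_(f in rearrangements x) states_event s f.
Proof.
move=> xN; apply/seteqP; split => [w wx|w [f fx wf] k].
  exists [tuple xi a s w | a < N]; last by move=> a _; rewrite /state_event/= tnth_mktuple.
  rewrite /rearrangements/=; apply/allP => k _ /=; rewrite count_config_list -wx.
  have /= -> := count_tnth [tuple xi a s w | a < N] k.
  by apply/eqP/eq_card => a; rewrite !inE tnth_mktuple.
rewrite -count_config_list -(seq.permP fx) count_tnth.
by apply: eq_card => a; rewrite !inE (wf a).
Qed.

Lemma finite_rearrangements x : finite_set (rearrangements x).
Proof.
have -> : rearrangements x = @tval _ _ @^-1` [set` permutations (config_list x)].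
  by apply/seteqP; split => f; rewrite /rearrangements/= mem_permutations.
by apply: finite_preimage => //; move=> f g _ _; exact: val_inj.
Qed.

Lemma states_event_inj s f g w : states_event s f w -> states_event s g w -> f = g.
Proof. by move=> fw gw; apply: eq_from_tnth => a; rewrite -(fw a)// -(gw a). Qed.

Lemma fine_fin_bigcup (I : choiceType) (D : set I) (F : I -> set T) :
  finite_set D -> trivIset D F -> (forall i, D i -> measurable (F i)) ->
  fine (P (\bigcup_(i in D) F i)) = \sum_(i \in D) fine (P (F i)).
Proof.
move=> fD tF mF; rewrite measure_fin_bigcup// !fsbig_finite//=.
rewrite big_seq [RHS]big_seq sum_fine// => i; rewrite in_fset_set ?inE// => Di.
by rewrite fin_num_measure//; exact: mF.
Qed.

Lemma counts_prob x : ctotal x = N ->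
  fine (P (counts_event xi 0 x)) = \sum_(f \in rearrangements x) fine (P (states_event 0 f)).
Proof.
move=> xN; rewrite counts_eventE// fine_fin_bigcup//.
- exact: finite_rearrangements.
- by move=> f g _ _ [w [fw gw]]; exact: states_event_inj gw.
- by move=> f _; exact: measurable_states.
Qed.

Lemma counts_transition x y : ctotal x = N -> ctotal y = N ->
  fine (P (counts_event xi t y `&` counts_event xi 0 x)) =
  \sum_(f \in rearrangements x) fine (P (states_event 0 f)) *
    \sum_(h \in rearrangements y) \prod_(a < N) p (tnth f a) (tnth h a) t.
Proof.
move=> xN yN; rewrite !counts_eventE//.
have -> : (\bigcup_(h in rearrangements y) states_event t h) `&`
    (\bigcup_(f in rearrangements x) states_event 0 f) =
    \bigcup_(fh in rearrangements x `*` rearrangements y)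
      (states_event 0 fh.1 `&` states_event t fh.2).
  apply/seteqP; split => [w [[h yh wh] [f xf wf]]|w [[f h] [/= xf yh] [wf wh]]].
    by exists (f, h).
  by split; [exists h|exists f].
have fx := finite_rearrangements x; have fy := finite_rearrangements y.
rewrite fine_fin_bigcup; first last.
- by move=> fh _; apply: measurableI; exact: measurable_states.
- move=> [f h] [g k] _ _ [w [[/= fw hw] [gw kw]]].
  by rewrite (states_event_inj fw gw) (states_event_inj hw kw).
- exact: finite_setX.
under [RHS]eq_fsbigr do rewrite mulr_fsumr.
rewrite [RHS]pair_fsbig//; apply: eq_fsbigr => fh _; exact: states_transition.
Qed.

(** For every initial assignment with counts [x] the sum over final assignments is the same, by
    invariance of the permanent; the arbitrary initial law therefore cancels. *)
Lemma counts_cond_prob x y (X Y : N.-tuple nat) :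
  tval X = config_list x -> tval Y = config_list y ->
  (0 < P (counts_event xi 0 x))%E ->
  cond_prob P (counts_event xi t y) (counts_event xi 0 x) =
  (size (permutations Y))%:R * (N`!%:R^-1 * permanent (fun i j => p i j t) X Y).
Proof.
move=> Xx Yy P0; have xN : ctotal x = N by rewrite -size_config_list -Xx size_tuple.
have yN : ctotal y = N by rewrite -size_config_list -Yy size_tuple.
have fP0 : fine (P (counts_event xi 0 x)) != 0.
  rewrite gt_eqF// fine_gt0// P0/= ltey_eq fin_num_measure//.
  rewrite counts_eventE//; apply: fin_bigcup_measurable => [|f _].
    exact: finite_rearrangements.
  exact: measurable_states.
rewrite /cond_prob counts_transition//; apply: (mulIf fP0); rewrite divfK//.
rewrite counts_prob// mulr_fsumr; apply: eq_fsbigr => f; rewrite inE /rearrangements/=.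
rewrite -Xx => /tuple_permP[sigma fE]; rewrite mulrC; congr (_ * _).
have {fE} -> : f = permute X sigma by exact: val_inj.
rewrite -(permanent_permute _ X Y sigma).
have N0 : N`!%:R != 0 :> R by rewrite pnatr_eq0 -lt0n fact_gt0.
(* The default of [nth] is never reached: [F] is evaluated only at arrangements of [Y], of length
   [N]. *)
pose F (s : seq nat) := \prod_(a < N) p (tnth (permute X sigma) a) (nth 0%N s a) t.
have := sum_permute Y F; rewrite mulrCA /permanent => e.
apply: (mulfI N0); rewrite mulVKf//.
have -> : \sum_(tau : 'S_N) \prod_(a < N) p (tnth (permute X sigma) a) (tnth Y (tau a)) t
    = \sum_(tau : 'S_N) F (permute Y tau).
  apply: eq_bigr => tau _; apply: eq_bigr => a _.
  by rewrite -tnth_nth [tnth (permute Y tau) a]tnth_mktuple.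
rewrite e; congr (_ * _); rewrite [RHS]fsbig_seq ?permutations_uniq//.
have bij : set_bij (rearrangements y) [set` permutations Y] (@tval _ _).
  split.
  - by move=> h; rewrite /rearrangements/= mem_permutations Yy.
  - by move=> h k _ _; exact: val_inj.
  - move=> s /=; rewrite mem_permutations => sY.
    have sN : size s == N by rewrite (perm_size sY) size_tuple.
    by exists (Tuple sN) => //; rewrite /rearrangements/= -Yy.
rewrite [RHS](reindex_fsbig _ _ _ _ bij); apply: eq_fsbigr => h _.
by apply: eq_bigr => a _; rewrite -tnth_nth.
Qed.

End IndependentProcesses.

(** * The theorem *)

Lemma cvg_nneseries {R : realType} (f : nat -> R) (s : R) :
  \sum_(k < K) f k @[K --> \oo] --> s -> (\sum_(k <oo) (f k)%:E = s%:E)%E.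
Proof.
move=> fs; apply/cvg_lim => //.
rewrite (_ : (fun n => _) = (fun K => (\sum_(k < K) f k)%:E)).
  by apply: cvg_EFin => //; exact: nearW.
by apply/funext => n; rewrite sumEFin big_mkord.
Qed.

(** At z = 0 the recurrence reads lambda_n (Q_{n+1} - Q_n) = mu_n (Q_n - Q_{n-1}). The first
    increment vanishes because [mu 0] is 0, hence all do. *)
Lemma spectral_polynomials_at0 {R : realType} (lambda mu : nat -> R) Q :
  (forall i, 0 < lambda i) -> mu 0%N = 0 -> spectral_polynomials lambda mu Q ->
  forall i, (Q i).[0] = 1.
Proof.
move=> l0 m0 [Q0 QE].
suff h i : (Q i).[0] = 1 /\ (Q i.+1).[0] = 1 by move=> i; have [] := h i.
elim: i => [|i [Qi Qi1]].
  have := congr1 (fun q => q.[0]) (QE 0%N).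
  rewrite Q0 m0 !hornerE => e; split=> //.
  by apply: (mulfI (lt0r_neq0 (l0 0%N))); move: e; lra.
split=> //; have := congr1 (fun q => q.[0]) (QE i.+1).
rewrite !hornerE Qi Qi1 => e; apply: (mulfI (lt0r_neq0 (l0 i.+1))).
by move: e; lra.
Qed.

Lemma pi_coef_gt0 {R : realType} (lambda mu : nat -> R) : (forall i, 0 < lambda i) ->
  (forall i, (1 <= i)%N -> 0 < mu i) -> forall j, 0 < pi_coef lambda mu j.
Proof. by move=> l0 m0 j; apply: prodr_gt0 => i _; rewrite divr_gt0// m0. Qed.

Lemma prod_config {R : realType} (x : config) (s : seq nat) (q : nat -> R) :
  (forall i, x i = count_mem i s) ->
  \prod_(j <- finsupp x) q j ^+ x j = \prod_(j <- s) q j.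
Proof.
move=> xs; rewrite -[RHS]big_undup_iterop_count/=.
by rewrite (perm_big _ (finsupp_undup xs))/=; apply: eq_bigr => i _; rewrite xs.
Qed.

Lemma sum_config {R : realType} (x : config) (s : seq nat) (q : nat -> R) :
  (forall i, x i = count_mem i s) ->
  \sum_(j <- finsupp x) (x j)%:R * q j = \sum_(j <- s) q j.
Proof.
move=> xs; rewrite -[RHS]big_undup_iterop_count/=.
by rewrite (perm_big _ (finsupp_undup xs))/=; apply: eq_bigr => i _; rewrite xs mulr_natl.
Qed.

Lemma multinomial_weight_permutations {R : realType} N (Y : N.-tuple nat) y (q : nat -> R) :
  tval Y = config_list y -> multinomial_weight N y q =
  (size (permutations Y))%:R * \prod_(a < N) q (tnth Y a).
Proof.
move=> Yy; have yY i : y i = count_mem i Y by rewrite Yy count_config_list.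
rewrite /multinomial_weight (prod_config _ yY) big_tuple; congr (_ * _).
by rewrite -(multinomial_permutations yY) size_tuple.
Qed.

Lemma permanent_scale {R : realType} N (X Y : N.-tuple nat) (B : nat -> nat -> R) q :
  permanent (fun i j => B i j * q j) X Y = permanent B X Y * \prod_(a < N) q (tnth Y a).
Proof.
rewrite /permanent mulr_suml; apply: eq_bigr => sigma _.
by rewrite big_split; congr (_ * _); rewrite [RHS](reindex_inj (@perm_inj _ sigma)).
Qed.

Lemma expR_labels {R : realType} (s : seq nat) (x : config) (zeta : nat -> R) t :
  (forall i, x i = count_mem i s) ->
  expR (- t * \sum_(i <- finsupp x) (x i)%:R * zeta i) =
  \prod_(l <- s) expR (- (zeta l * t)).
Proof.
move=> xs; rewrite (sum_config _ xs) mulr_sumr expR_sum.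
apply: eq_bigr => l _. by rewrite mulNr mulrC.
Qed.

Lemma labelings_nseq0 N : labelings N (multi_index (nseq N 0%N)) = [set nseq N 0%N].
Proof.
apply/seteqP; split => [M [sM mM]|_ ->] /=; last by split=> //; rewrite size_nseq.
rewrite -sM; apply/all_pred1P; rewrite all_count count0 mM ctotal_multi_index.
by rewrite count_nseq mul0n subn0.
Qed.

Lemma krawtchouk_index0 {R : realType} (u : nat -> nat -> R) (x : config) :
  (forall i, u 0%N i = 1) -> krawtchouk u (multi_index (nseq (ctotal x) 0%N)) x = 1.
Proof.
move=> u1; rewrite krawtchouk_labelings labelings_nseq0 fsbig_set1.
rewrite -size_config_list /labeling_weight.
by elim: (config_list x) => [|i s IH]; rewrite ?big_nil// big_cons u1 mul1r.
Qed.

Lemma multinomial_index0 {R : realType} N :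
  multinomial N (full_index N (multi_index (nseq N 0%N))) = 1 :> R.
Proof.
have := multinomial_permutations (R := R) (full_index_count (nseq N 0%N)).
have sub : {subset nseq N 0%N <= [:: 0%N]}.
  by move=> i; rewrite mem_nseq inE => /andP[].
have := size_permutations_fact (isT : uniq [:: 0%N]) sub.
rewrite big_seq1 count_nseq mul1n size_nseq => /eqP.
by rewrite -[eqbRHS]mul1n eqn_pmul2r ?fact_gt0// => /eqP -> ->.
Qed.

Section Assembly.
Context {R : realType} (N : nat) (lambda mu : nat -> R)
  (p : nat -> nat -> R -> R)
  (d : measure_display) (T : measurableType d) (P : probability T R)
  (xi : 'I_N -> R -> T -> nat)
  (hxi : forall k, birth_death_process P lambda mu p (xi k))
  (hind : independent_processes P xi).

(** The common core of both parts, with [q] the stationary distribution or [pi_coef]. Dividing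
    [p i j t] by [q j] leaves a kernel with a symmetric expansion in [u]; the factors [q j] taken
    out of the permanent, with the number of arrangements, form the weight. *)
Lemma counts_krawtchouk (u : nat -> nat -> R) (rho q : nat -> R) (E : config -> R)
    (x y : config) (t : R) : 0 <= t ->
  (forall j, 0 < q j) ->
  (forall i j, has_usum setT (fun l => rho l * (u l i * u l j)) (p i j t / q j)) ->
  (forall L : N.-tuple nat, E (multi_index L) = \prod_(a < N) rho (tnth L a)) ->
  ctotal x = N -> ctotal y = N -> (0 < P (counts_event xi 0 x))%E ->
  exists2 s, has_usum [set n : config | n 0%N = 0%N /\ (ctotal n <= N)%N]
    (fun n => E n * (multinomial N (full_index N n))^-1
              * krawtchouk u n x * krawtchouk u n y) s &
  cond_prob P (counts_event xi t y) (counts_event xi 0 x) =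
  multinomial_weight N y q * s.
Proof.
move=> t0 q0 hB hE xN yN P0.
have xT : size (config_list x) == N by rewrite size_config_list xN.
have yT : size (config_list y) == N by rewrite size_config_list yN.
pose X := Tuple xT; pose Y := Tuple yT.
exists (N`!%:R^-1 * permanent (fun i j => p i j t / q j) X Y).
  exact: krawtchouk_usum.
rewrite (counts_cond_prob hxi hind t0 (X := X) (Y := Y))//.
rewrite (multinomial_weight_permutations (Y := Y))//.
rewrite -[in LHS](_ : (fun i j => p i j t / q j * q j) = (fun i j => p i j t)).
  by rewrite permanent_scale; ring.
by apply/funext => i; apply/funext => j; rewrite divfK// gt_eqF.
Qed.

End Assembly.

(** If a stationary distribution exists and [mu 0] is 0, then 0 is an atom and may be listed as
    [zeta 0]; in (ii) the positivity of [zeta 0] is therefore asserted when the sum of the [pi_coef]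
    diverges. *)
Theorem theorem9 (R : realType) (N : nat) (hN : (1 <= N)%N)
  (lambda mu : nat -> R)
  (hlambda : forall i, 0 < lambda i) (hmu : forall i, (1 <= i)%N -> 0 < mu i)
  (p : nat -> nat -> R -> R)
  (d : measure_display) (T : measurableType d) (P : probability T R)
  (xi : 'I_N -> R -> T -> nat)
  (hxi : forall k, birth_death_process P lambda mu p (xi k))
  (hind : independent_processes P xi)
  (Q : nat -> {poly R}) (hQ : spectral_polynomials lambda mu Q)
  (psi : probability (measurableTypeR R) R)
  (hpsi : spectral_measure lambda mu p Q psi)
  (zeta : nat -> R) (hzeta : discrete_spectrum psi zeta) :
  (mu 0%N = 0 -> zeta 0%N = 0 ->
   forall ps : nat -> R, stationary_distribution p ps ->
   let u l i := (Q i).[zeta l] * Num.sqrt (atom psi (zeta l) / atom psi 0) in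
   forall (x y : config) (t : R), ctotal x = N -> ctotal y = N -> 0 <= t ->
   (0 < P (counts_event xi 0 x))%E ->
   let D := [set n : config | n 0%N = 0%N /\ (0 < ctotal n <= N)%N] in
   let term n :=
     expR (- t * \sum_(i <- finsupp n) (n i)%:R * zeta i)
     * (multinomial N (full_index N n))^-1
     * krawtchouk u n x * krawtchouk u n y in
   summable D (EFin \o term) /\
   cond_prob P (counts_event xi t y) (counts_event xi 0 x) =
     multinomial_weight N y ps * (1 + usum D term))
  /\
  (mu 0%N = 0 ->
   let u l i := (Q i).[zeta l] * Num.sqrt (atom psi (zeta l)) in
   [/\ (forall (x y : config) (t : R), ctotal x = N -> ctotal y = N -> 0 <= t ->
        (0 < P (counts_event xi 0 x))%E ->
        let D := [set n : config | n 0%N = 0%N /\ (0 <= ctotal n <= N)%N] in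
        let term n :=
          expR (- t * \sum_(i <- finsupp (full_index N n))
                        (full_index N n i)%:R * zeta i)
          * (multinomial N (full_index N n))^-1
          * krawtchouk u n x * krawtchouk u n y in
        summable D (EFin \o term) /\
        cond_prob P (counts_event xi t y) (counts_event xi 0 x) =
          multinomial_weight N y (pi_coef lambda mu) * usum D term),
       (~ (forall i, u 0%N i = 1)),
       (forall k l,
          series (fun i => u k i * u l i * pi_coef lambda mu i) @ \oo
            --> ((k == l)%:R : R))
     & ((\sum_(k <oo) (pi_coef lambda mu k)%:E = +oo)%E ->
        ~ (exists ps : nat -> R, stationary_distribution p ps)
        /\ 0 < zeta 0%N)]).
Proof.
have [hp _ _ _] := hxi (Ordinal hN).
have Q0 : Q 0%N = 1 by case: hQ.
have pi0 := pi_coef_gt0 hlambda hmu.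
have [zinj z0 atom0 _] := hzeta.
have psi_sum t i j (t0 : 0 <= t) := spectral_usum hpsi i hzeta t0 (pi0 j).
(* Dual orthogonality carries the full mass of each atom; one square root of each is divided out. *)
have u_orth k l : series (fun i => (Q i).[zeta k] * Num.sqrt (atom psi (zeta k))
    * ((Q i).[zeta l] * Num.sqrt (atom psi (zeta l))) * pi_coef lambda mu i) @ \oo
    --> ((k == l)%:R : R).
  have := dual_orthogonality pi0 Q0 hp hpsi (z0 k) (z0 l).
  set S := (X in X @ _ --> _) => SE; pose c i := Num.sqrt (atom psi (zeta i)).
  have c0 i : c i != 0 by rewrite gt_eqF// sqrtr_gt0.
  have cc i : atom psi (zeta i) = c i * c i by rewrite -expr2 sqr_sqrtr// ltW.
  have -> : (k == l)%:R = (zeta k == zeta l)%:R * atom psi (zeta l) * (c k * c l)^-1.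
    rewrite (inj_eq zinj); case: eqP => [->|_]; last by rewrite !mul0r.
    by rewrite mul1r cc divff// mulf_neq0.
  rewrite (_ : series _ = (fun K => S K * (c k * c l)^-1)).
    by apply: (cvgM SE); exact: cvg_cst.
  apply/funext => K; rewrite seriesEord/= mulr_suml; apply: eq_bigr => i _.
  by rewrite /qfun -/(c k) -/(c l) !cc; field; rewrite !c0.
split.
  move=> mu0 zeta0 ps psP u x y t xN yN t0 P0 D term.
  have Q1 := spectral_polynomials_at0 hlambda mu0 hQ.
  have psE := stationary_limit hp hpsi pi0 Q1 psP.
  have a0 : 0 < atom psi 0 by have := atom0 0%N; rewrite zeta0.
  pose rho l := expR (- (zeta l * t)).
  have [] := @counts_krawtchouk _ _ _ _ _ _ _ _ _ hxi hind u rho ps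
    (fun n => expR (- t * \sum_(i <- finsupp n) (n i)%:R * zeta i)) x y t t0 _ _ _ xN yN P0.
  - by move=> j; rewrite psE mulr_gt0.
  (* Here [ps j] is [pi_coef lambda mu j * atom psi 0], and the extra factor is absorbed by the
     denominator under the square root in [u]. *)
  - move=> i j; rewrite psE invfM mulrA mulrC.
    apply: eq_has_usum (has_usumZ _ (psi_sum t i j t0)) => l _.
    rewrite /u /rho mulrACA -expr2 sqr_sqrtr; first by ring.
    by rewrite divr_ge0// ltW.
  (* Labels 0 are missing from [multi_index], but each carries the factor 1 because [zeta 0] is
     0. *)
  - move=> L; rewrite (expR_labels _ _ (multi_index_count L)) big_filter.
    rewrite big_mkcond big_tuple; apply: eq_bigr => a _.
    by case: eqP => //= ->; rewrite /rho zeta0 mul0r oppr0 expR0.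
  move=> s hs ->.
  (* The zero multi-index supplies the leading 1 of the formula; it is written through the all-zero
     labeling so that the results on labelings apply. *)
  pose n0 := multi_index (nseq N 0%N).
  have n0E i : n0 i = 0%N.
    by rewrite multi_indexE count_nseq; case: i.
  have cn0 : ctotal n0 = 0%N by rewrite ctotal_multi_index count_nseq mul0n.
  have Dn0 : [set n : config | n 0%N = 0%N /\ (ctotal n <= N)%N] n0 by rewrite /= n0E cn0.
  have := has_usum_rem Dn0 hs.
  have -> : [set n : config | n 0%N = 0%N /\ (ctotal n <= N)%N] `\ n0 = D.
    apply/seteqP; split => n /=.
      move=> [[n_0 nN] nn0]; split=> //; rewrite nN andbT lt0n; apply/eqP => cn.
      apply: nn0; have [L sL mL] := multi_index_surj n_0 (eq_leq cn).
      apply/fsfunP => i; rewrite n0E -mL.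
      by move: sL => /size0nil ->; rewrite multi_indexE; case: eqP.
    by move=> [n_0 /andP[cn nN]]; split => // nn0; rewrite nn0 cn0 in cn.
  have u1 i : u 0%N i = 1 by rewrite /u zeta0 Q1 divff ?gt_eqF// sqrtr1 mul1r.
  have k0 z : ctotal z = N -> krawtchouk u n0 z = 1.
    by move=> zN; rewrite /n0 -zN; exact: krawtchouk_index0.
  rewrite (expR_labels (s := [::]))// big_nil multinomial_index0 !k0// invr1 !mul1r.
  by move=> [hsum uE]; split=> //; rewrite uE; ring.
move=> mu0 u.
have Q1 := spectral_polynomials_at0 hlambda mu0 hQ.
split.
- move=> x y t xN yN t0 P0 D term.
  have [|||] := @counts_krawtchouk _ _ _ _ _ _ _ _ _ hxi hind u
    (fun l => expR (- (zeta l * t))) (pi_coef lambda mu)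
    (fun n => expR (- t * \sum_(i <- finsupp (full_index N n)) (full_index N n i)%:R * zeta i))
    x y t t0 _ _ _ xN yN P0.
  - by [].
  - move=> i j; apply: eq_has_usum (psi_sum t i j t0) => l _.
    by rewrite /u mulrACA -expr2 sqr_sqrtr// ltW.
  - move=> L; have := full_index_count L; rewrite size_tuple => fL.
    rewrite (expR_labels _ _ fL).
    by rewrite big_tuple.
  have -> : D = [set n : config | n 0%N = 0%N /\ (ctotal n <= N)%N].
    by apply/seteqP; split.
  by move=> s [hs <-] ->.
(* At state 0 the value 1 would put mass 1 at [zeta 0], leaving none for the distinct atom
   [zeta 1]. *)
- move=> /(_ 0%N); rewrite /u Q0 hornerC mul1r => /(congr1 (fun x => x ^+ 2)).
  rewrite sqr_sqrtr ?ltW// expr1n => a1.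
  have : (psi [set zeta 0%N] + psi [set zeta 1%N] <= 1)%E.
    rewrite -measureU//; first exact/probability_le1/measurableU.
    by apply/seteqP; split => // z [/= -> /zinj].
  rewrite !atom_fin a1 -EFinD lee_fin gerDl leNgt.
  by rewrite (atom0 1%N).
- exact: u_orth.
- move=> pi_oo.
  (* Both conclusions contradict this: a stationary distribution is a multiple of [pi_coef] with sum
     1, and [zeta 0 = 0] would turn the orthogonality relation for [k = l = 0] into such a finite
     sum. *)
  have pi_scale c s : 0 < c -> (\sum_(k <oo) (c * pi_coef lambda mu k)%:E)%E <> s%:E.
    move=> c0; under eq_eseriesr do rewrite EFinM.
    rewrite nneseriesZl => [|k _]; last exact/ltW/pi0.
    by rewrite pi_oo gt0_muley// lte_fin.
  split.
    move=> [ps psP]; have psE := stationary_limit hp hpsi pi0 Q1 psP.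
    have [_ + _] := psP; under eq_eseriesr do rewrite psE mulrC.
    have [a0|] := ltP 0 (atom psi 0); first exact: pi_scale.
    rewrite le_eqVlt ltNge fine_ge0// orbF => /eqP ->.
    by rewrite eseries0 => [[]/esym/eqP|k _ _]; rewrite ?oner_eq0// mul0r.
  rewrite lt_neqAle z0 andbT eq_sym; apply/eqP => zeta0.
  have := u_orth 0%N 0%N; rewrite eqxx => uo.
  apply: (pi_scale _ _ (atom0 0%N)); apply: cvg_nneseries (1 : R) _.
  rewrite [X in X @ _ --> _](_ : _ =
    series (fun i => u 0%N i * u 0%N i * pi_coef lambda mu i))//.
  apply/funext => K; rewrite seriesEord; apply: eq_bigr => i _ /=.
  by rewrite /u zeta0 Q1 mul1r -expr2 sqr_sqrtr//; have := atom0 0%N; rewrite zeta0 => /ltW.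
Qed.
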